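(* Let the Smoothness Assumption (stated in the context) hold, and consider the HJB equation $$ \frac {\partial V}{\partial t}(t,x)+(\mathcal {L}V)(t,x)+ H(t,x,\mathrm{D}_xV(t,x),\mathrm{D}^2_{xx}V(t,x))=0,\ (t,x)\in [0,T]\times\mathbb R^n,\qquad V(T,x)=g(x). $$ (1) If the Uniform Convexity Assumption (stated in the context) holds, then the HJB equation admits at most one classical solution $V\in C^{1,2}([0,T]\times\mathbb R^n;\mathbb R)$ such that $\mathrm D^2_{xx}V$ is uniformly bounded and such that there exists a constant $\delta>0$ with $$ \mathrm D^2_{uu}l(t,x,u)+\sum_{i=1}^d D_i(t)^\top \mathrm D^2_{xx}V(t,x)D_i(t)\geq\delta I_m\quad\text{for all }(t,x,u)\in[0,T]\times\mathbb R^{n}\times\mathbb R^m. $$ (2) If, in place of the Uniform Convexity Assumption, there is a constant $\delta>0$ such that for almost all $t\in[0,T]$ the functions $g(x)$ and $l(t,x,u)-\frac\delta2|u|^2$ are convex in $(x,u)$, then the HJB equation admits at most one classical solution $V\in C^{1,2}([0,T]\times\mathbb R^n;\mathbb R)$ which is convex in $x$ for any $t\in[0,T]$ and for which $\mathrm D^2_{xx}V$ is uniformly bounded.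
   Context: Setting. $T>0$ and $n,m,d\ge1$ are fixed. $(\Omega,\mathcal F,\mathbb F,\mathbb P)$ is a complete filtered probability space carrying a $d$-dimensional standard Brownian motion $W=(W^1,\dots,W^d)^\top$, and $\mathbb F=\{\mathcal F_t\}_{0\le t\le T}$ is the augmented natural filtration of $W$. The coefficients $A,C_1,\dots,C_d:[0,T]\to\mathbb R^{n\times n}$, $B,D_1,\dots,D_d:[0,T]\to\mathbb R^{n\times m}$, $b,\sigma_1,\dots,\sigma_d:[0,T]\to\mathbb R^n$, $g:\mathbb R^n\to\mathbb R$, $l:[0,T]\times\mathbb R^n\times\mathbb R^m\to\mathbb R$ are deterministic; $C=(C_1^\top,\dots,C_d^\top)^\top$, $D=(D_1^\top,\dots,D_d^\top)^\top$, $\sigma=(\sigma_1^\top,\dots,\sigma_d^\top)^\top$. $\mathrm D_x,\mathrm D_u$ are gradients (column vectors) and $\mathrm D^2_{xx}=\mathrm D_x\mathrm D_x^\top$, $\mathrm D^2_{xu}=\mathrm D_x\mathrm D_u^\top$, $\mathrm D^2_{ux}=\mathrm D_u\mathrm D_x^\top$, $\mathrm D^2_{uu}=\mathrm D_u\mathrm D_u^\top$. For symmetric matrices, $M\ge N$ means $M-N$ is positive semidefinite. Control problem. $\mathscr U_{\mathrm{ad}}[t,T]$ is the set of $\mathbb F$-adapted $\mathbb R^m$-valued processes $u$ on $[t,T]$ with $\|u\|_{L^2}^2=\mathbb E\int_t^T|u_s|^2\mathrm ds<\infty$. For $\xi\in L^2_{\mathcal F_t}(\Omega;\mathbb R^n)$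 (square-integrable, $\mathcal F_t$-measurable), $X^{t,\xi,u}$ solves $\mathrm dX_s=[A(s)X_s+B(s)u_s+b(s)]\mathrm ds+\sum_{i=1}^d[C_i(s)X_s+D_i(s)u_s+\sigma_i(s)]\mathrm dW^i_s$, $s\in[t,T]$, $X_t=\xi$, and $J(t,\xi;u)=\mathbb E[g(X^{t,\xi,u}_T)+\int_t^Tl(s,X^{t,\xi,u}_s,u_s)\mathrm ds]$. Smoothness Assumption. All coefficients are deterministic; the derivatives $\mathrm D_xg,\mathrm D^2_{xx}g,\mathrm D_xl,\mathrm D_ul,\mathrm D^2_{xx}l,\mathrm D^2_{xu}l,\mathrm D^2_{ux}l,\mathrm D^2_{uu}l$ exist; $A,B,C,D,b,\sigma,g,l$ and all these derivatives are jointly continuous in $(t,x,u)$; all second-order derivatives of $g,l$ are uniformly bounded. Uniform Convexity Assumption. There is a constant $\delta>0$ such that for any $(t,\xi)\in[0,T]\times L^2_{\mathcal F_t}(\Omega;\mathbb R^n)$ the mapping $u\mapsto J(t,\xi;u)-\frac\delta2\|u\|_{L^2}^2$ is convex on $\mathscr U_{\mathrm{ad}}[t,T]$. HJB notation. $(\mathcal LV)(t,x)=\langle \mathrm D_xV(t,x),A(t)x+b(t)\rangle+\frac12\sum_{i=1}^d\langle \mathrm D^2_{xx}V(t,x)[C_i(t)x+\sigma_i(t)],C_i(t)x+\sigma_i(t)\rangle$; $H(t,x,p,Q)=\inf_{u\in\mathbb R^m}\mathcal H(t,x,p,Q,u)$, where $\mathcal H(t,x,p,Q,u)=\langle u,B(t)^\top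 p+\sum_{i=1}^dD_i(t)^\top Q[C_i(t)x+\sigma_i(t)]\rangle+\frac12\sum_{i=1}^d\langle D_i(t)^\top QD_i(t)u,u\rangle+l(t,x,u)$. *)

(* Defs.v *)
From HB Require Import structures.
From mathcomp Require Import all_boot all_order all_algebra.
From mathcomp Require Import all_classical all_reals all_analysis.

Set Implicit Arguments.
Unset Strict Implicit.
Unset Printing Implicit Defensive.

Import Order.TTheory GRing.Theory Num.Theory.
Import numFieldNormedType.Exports.

Local Open Scope classical_set_scope.
Local Open Scope ring_scope.

Section Euclidean.
Context {R : realType}.

(* Euclidean structure on column vectors.  The library norm on matrices is the
   max norm, so |u|^2 is always written [sqnorm u]. *)
Definition dot n (u v : 'cV[R]_n) : R := \sum_i u i ord0 * v i ord0.

Definition sqnorm n (u : 'cV[R]_n) : R := dot u u.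

(* The order is only used on symmetric matrices. *)
Definition psdmx n (M : 'M[R]_n) : Prop :=
  forall v : 'cV[R]_n, 0 <= dot (M *m v) v.

Definition mxge n (M N : 'M[R]_n) : Prop := psdmx (M - N).

Definition basis_vec n (i : 'I_n) : 'cV[R]_n := delta_mx i ord0.

End Euclidean.

Section SpaceDerivatives.
Context {R : realType}.

Definition grad n (f : 'cV[R]_n -> R) (x : 'cV[R]_n) : 'cV[R]_n :=
  \col_i 'D_(basis_vec i) f x.

Definition has_grad n (f : 'cV[R]_n -> R) : Prop :=
  forall x i, derivable f x (basis_vec i).

(* D_x D_u^T f : entry (i, j) is d/dx_i (d/du_j f). *)
Definition mixed n m (f : 'cV[R]_n -> 'cV[R]_m -> R)
    (x : 'cV[R]_n) (u : 'cV[R]_m) : 'M[R]_(n, m) :=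
  \matrix_(i, j) 'D_(basis_vec i) (fun y => grad (f y) u j ord0) x.

Definition has_mixed n m (f : 'cV[R]_n -> 'cV[R]_m -> R) : Prop :=
  forall u (j : 'I_m), has_grad (fun y => grad (f y) u j ord0).

(* D_x D_x^T f : entry (i, j) is d/dx_i (d/dx_j f). *)
Definition hess n (f : 'cV[R]_n -> R) (x : 'cV[R]_n) : 'M[R]_n :=
  \matrix_(i, j) 'D_(basis_vec i) (fun y => grad f y j ord0) x.

Definition has_hess n (f : 'cV[R]_n -> R) : Prop :=
  forall j : 'I_n, has_grad (fun y => grad f y j ord0).

End SpaceDerivatives.

(* Time-dependent data are total functions of the time variable; only their
   values on [0, T] are ever used. *)
Record coefficients (R : realType) (n m d : nat) := Coefficients {
  cA : R -> 'M[R]_n ;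
  cB : R -> 'M[R]_(n, m) ;
  cb : R -> 'cV[R]_n ;
  cC : 'I_d -> R -> 'M[R]_n ;
  cD : 'I_d -> R -> 'M[R]_(n, m) ;
  csigma : 'I_d -> R -> 'cV[R]_n ;
  cg : 'cV[R]_n -> R ;
  cl : R -> 'cV[R]_n -> 'cV[R]_m -> R }.

Section Smoothness.
Context {R : realType}.

Definition cont_t (T : R) (E : topologicalType) (f : R -> E) : Prop :=
  {within `[0, T], continuous f}.

Definition cont_tx (T : R) n (E : topologicalType)
    (f : R -> 'cV[R]_n -> E) : Prop :=
  {within `[0, T] `*` setT, continuous (fun z : R * 'cV[R]_n => f z.1 z.2)}.

Definition cont_txu (T : R) n m (E : topologicalType)
    (f : R -> 'cV[R]_n -> 'cV[R]_m -> E) : Prop :=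
  {within (`[0, T] `*` setT) `*` setT,
    continuous (fun z : R * 'cV[R]_n * 'cV[R]_m => f z.1.1 z.1.2 z.2)}.

Definition bounded_txu (T : R) n m p q
    (f : R -> 'cV[R]_n -> 'cV[R]_m -> 'M[R]_(p, q)) : Prop :=
  exists K : R, forall t x u, t \in `[0, T] -> `|f t x u| <= K.

Definition smoothness n m d (T : R) (c : coefficients R n m d) : Prop :=
  let g := cg c in
  let l := cl c in
  let lx t x u := grad (fun y => l t y u) x in
  let lu t x u := grad (l t x) u in
  let lxx t x u := hess (fun y => l t y u) x in
  let lxu t x u := mixed (l t) x u in
  let lux t x u := mixed (fun v y => l t y v) u x in
  let luu t x u := hess (l t x) u in
  [/\ [/\ cont_t T (cA c), cont_t T (cB c), cont_t T (cb c),
          forall i, cont_t T (cC c i) &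
          (forall i, cont_t T (cD c i)) /\ (forall i, cont_t T (csigma c i))],
      [/\ has_grad g, has_hess g, continuous g,
          continuous (grad g) & continuous (hess g)],
      [/\ forall t u, t \in `[0, T] -> has_grad (fun y => l t y u),
          forall t x, t \in `[0, T] -> has_grad (l t x),
          forall t u, t \in `[0, T] -> has_hess (fun y => l t y u),
          forall t x, t \in `[0, T] -> has_hess (l t x) &
          forall t, t \in `[0, T] ->
            has_mixed (l t) /\ has_mixed (fun v y => l t y v)],
      [/\ cont_txu T l, cont_txu T lx /\ cont_txu T lu,
          cont_txu T lxx /\ cont_txu T luu, cont_txu T lxu & cont_txu T lux] &
      [/\ exists K : R, forall x, `|hess g x| <= K,
          bounded_txu T lxx, bounded_txu T lxu,
          bounded_txu T lux & bounded_txu T luu]].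

End Smoothness.

Section Hjb.
Context {R : realType}.

(* Time derivative relative to [0, T]: one-sided at the two endpoints. *)
Definition time_quotients (T : R) n (V : R -> 'cV[R]_n -> R) t x :=
  (fun s => (s - t)^-1 * (V s x - V t x)) @ within `[0, T] t^'.

Definition time_derivable T n (V : R -> 'cV[R]_n -> R) t x : Prop :=
  cvg (time_quotients T V t x).

Definition Dt T n (V : R -> 'cV[R]_n -> R) t x : R :=
  lim (time_quotients T V t x).

Definition C12 (T : R) n (V : R -> 'cV[R]_n -> R) : Prop :=
  [/\ forall t x, t \in `[0, T] -> time_derivable T V t x,
      forall t, t \in `[0, T] -> has_grad (V t),
      forall t, t \in `[0, T] -> has_hess (V t),
      cont_tx T V /\ cont_tx T (Dt T V) &
      cont_tx T (fun t => grad (V t)) /\ cont_tx T (fun t => hess (V t))].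

Variables (n m d : nat) (c : coefficients R n m d).

Definition vol0 (i : 'I_d) t (x : 'cV[R]_n) : 'cV[R]_n :=
  cC c i t *m x + csigma c i t.

Definition generator (V : R -> 'cV[R]_n -> R) t x : R :=
  dot (grad (V t) x) (cA c t *m x + cb c t)
  + 2^-1 * \sum_i dot (hess (V t) x *m vol0 i t x) (vol0 i t x).

Definition preHamiltonian t x (p : 'cV[R]_n) (Q : 'M[R]_n) (u : 'cV[R]_m) : R :=
  dot u ((cB c t)^T *m p + \sum_i (cD c i t)^T *m Q *m vol0 i t x)
  + 2^-1 * \sum_i dot ((cD c i t)^T *m Q *m cD c i t *m u) u
  + cl c t x u.

(* The infimum is taken in the extended reals: it may be -oo. *)
Definition Hamiltonian t x p Q : \bar R :=
  ereal_inf [set (preHamiltonian t x p Q u)%:E | u in [set: 'cV[R]_m]].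

Definition classical_solution (T : R) (V : R -> 'cV[R]_n -> R) : Prop :=
  [/\ C12 T V,
      forall t x, t \in `[0, T] ->
        ((Dt T V t x + generator V t x)%:E
          + Hamiltonian t x (grad (V t) x) (hess (V t) x) = 0)%E &
      forall x, V T x = cg c x].

Definition bounded_hess (T : R) (V : R -> 'cV[R]_n -> R) : Prop :=
  exists K : R, forall t x, t \in `[0, T] -> `|hess (V t) x| <= K.

Definition strongly_convex_control (T : R) (V : R -> 'cV[R]_n -> R) : Prop :=
  exists2 delta : R, 0 < delta & forall t x u, t \in `[0, T] ->
    mxge (hess (cl c t x) u
          + \sum_i (cD c i t)^T *m hess (V t) x *m cD c i t)
         delta%:M.

End Hjb.

Section Stochastic.
Context {R : realType} {dsp : measure_display} {Omega : measurableType dsp}.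
Variable P : probability Omega R.

Local Notation leb := (@lebesgue_measure R).

Section Filtration.
Variables (d : nat) (W : R -> Omega -> 'cV[R]_d).

Definition augmented_filtration (t : R) : set (set Omega) :=
  <<s [set E | P.-negligible E
       \/ exists s i (B : set (measurableTypeR R)),
            [/\ 0 <= s <= t, measurable B &
                E = (fun w => W s w i ord0) @^-1` B]] >>.

(* The product formula says at once that W_t - W_s is independent of F_s, that
   its components are independent, and that each of them is N(0, t - s);
   the second parameter of [normal_prob] is the standard deviation. *)
Definition brownian_motion (T : R) : Prop :=
  [/\ forall t i, t \in `[0, T] ->
        measurable_fun setT (fun w => W t w i ord0 : measurableTypeR R),
      {ae P, forall w, W 0 w = 0},
      {ae P, forall w, {within `[0, T], continuous (W ^~ w)}} &
      forall s t, 0 <= s -> s < t -> t <= T ->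
      forall (E : set Omega) (B : 'I_d -> set (measurableTypeR R)),
        augmented_filtration s E -> (forall i, measurable (B i)) ->
        P (E `&` [set w | forall i, B i ((W t w - W s w) i ord0)])
        = (P E * \prod_i normal_prob 0 (Num.sqrt (t - s)) (B i))%E].

Definition Ft_measurable t (X : Omega -> R) : Prop :=
  forall B : set (measurableTypeR R), measurable B ->
    augmented_filtration t (X @^-1` B).

(* Scalar adapted processes on [a, b].  Joint measurability in (s, w) is part of
   the definition, so that the time integrals make sense. *)
Definition adapted (a b : R) (Z : R -> Omega -> R) : Prop :=
  measurable_fun ((`[a, b]%classic : set (measurableTypeR R)) `*` setT)
    (fun z : measurableTypeR R * Omega => Z z.1 z.2 : measurableTypeR R)
  /\ forall s, s \in `[a, b] -> Ft_measurable s (Z s).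

Definition L2_variable t k (xi : Omega -> 'cV[R]_k) : Prop :=
  (forall j, Ft_measurable t (fun w => xi w j ord0))
  /\ (\int[P]_w (sqnorm (xi w))%:E < +oo)%E.

Definition L2_process a b k (u : R -> Omega -> 'cV[R]_k) : Prop :=
  (forall j, adapted a b (fun s w => u s w j ord0))
  /\ (\int[P]_w \int[leb]_(s in `[a, b]) (sqnorm (u s w))%:E < +oo)%E.

Definition sqnormL2 a b k (u : R -> Omega -> 'cV[R]_k) : R :=
  \int[P]_w \int[leb]_(s in `[a, b]) sqnorm (u s w).

(* Step processes sum_k zeta_k 1_{]tau_k, tau_(k+1)]}, k < N. *)
Record step_process := StepProcess {
  sp_size : nat ;
  sp_time : nat -> R ;
  sp_coef : nat -> Omega -> R }.

Definition admissible_step a b (S : step_process) : Prop :=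
  [/\ sp_time S 0 = a, sp_time S (sp_size S) = b,
      forall k, (k < sp_size S)%N -> sp_time S k <= sp_time S k.+1,
      forall k, (k < sp_size S)%N -> Ft_measurable (sp_time S k) (sp_coef S k) &
      exists K : R, forall k w, (k < sp_size S)%N -> `|sp_coef S k w| <= K].

Definition step_value (S : step_process) (r : R) (w : Omega) : R :=
  \sum_(k < sp_size S)
    sp_coef S k w * \1_(`]sp_time S k, sp_time S k.+1]%classic) r.

Definition step_integral (i : 'I_d) (S : step_process) (w : Omega) : R :=
  \sum_(k < sp_size S)
    sp_coef S k w * (W (sp_time S k.+1) w - W (sp_time S k) w) i ord0.

(* I is (a version of) int_a^b Z_r dW^i_r: the L^2 limit of the integrals of
   step processes approximating Z in L^2([a, b] x Omega). *)
Definition ito_integral (i : 'I_d) a b (Z : R -> Omega -> R)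
    (I : Omega -> R) : Prop :=
  [/\ adapted a b Z,
      measurable_fun setT (I : Omega -> measurableTypeR R) &
      exists S : nat -> step_process,
        [/\ forall k, admissible_step a b (S k),
            (\int[P]_w \int[leb]_(r in `[a, b])
               ((step_value (S k) r w - Z r w) ^+ 2)%:E)%E
              @[k --> \oo] --> 0%E &
            (\int[P]_w ((step_integral i (S k) w - I w) ^+ 2)%:E)%E
              @[k --> \oo] --> 0%E]].

Variables (n m : nat) (T : R) (c : coefficients R n m d).

Definition state_drift (X : R -> Omega -> 'cV[R]_n) (u : R -> Omega -> 'cV[R]_m)
    s w : 'cV[R]_n :=
  cA c s *m X s w + cB c s *m u s w + cb c s.

Definition state_vol (X : R -> Omega -> 'cV[R]_n) (u : R -> Omega -> 'cV[R]_m)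
    (i : 'I_d) s w : 'cV[R]_n :=
  cC c i s *m X s w + cD c i s *m u s w + csigma c i s.

Definition is_state t (xi : Omega -> 'cV[R]_n) (u : R -> Omega -> 'cV[R]_m)
    (X : R -> Omega -> 'cV[R]_n) : Prop :=
  [/\ L2_process t T X,
      {ae P, forall w, {within `[t, T], continuous (X ^~ w)}} &
      exists I : 'I_d -> R -> Omega -> 'cV[R]_n,
        (forall i s j, s \in `[t, T] ->
           ito_integral i t s (fun r w => state_vol X u i r w j ord0)
             (fun w => I i s w j ord0))
        /\ forall s, s \in `[t, T] -> {ae P, forall w,
             X s w = xi w
               + \col_j \int[leb]_(r in `[t, s]) state_drift X u r w j ord0
               + \sum_i I i s w}].

(* The solution of the state equation is unique up to indistinguishability, on
   which the cost does not depend, so any solution may be selected. *)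
Definition state t xi u : R -> Omega -> 'cV[R]_n :=
  xget (fun _ _ => 0) [set X | is_state t xi u X].

Definition cost t xi u : R :=
  let X := state t xi u in
  \int[P]_w (cg c (X T w) + \int[leb]_(s in `[t, T]) cl c s (X s w) (u s w)).

Definition Uad t : set (R -> Omega -> 'cV[R]_m) :=
  [set u | L2_process t T u].

Definition uniform_convexity : Prop :=
  exists2 delta : R, 0 < delta &
    forall t xi, t \in `[0, T] -> L2_variable t xi ->
      convex_function (Uad t)
        (fun u => cost t xi u - delta / 2 * sqnormL2 t T u).

End Filtration.
End Stochastic.

Section ConvexData.
Context {R : realType}.

Definition convex_data n m d (T : R) (c : coefficients R n m d) : Prop :=
  exists2 delta : R, 0 < delta &
    {ae @lebesgue_measure R, forall t, t \in `[0, T] ->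
      convex_function setT (cg c)
      /\ convex_function setT (fun z : 'cV[R]_n * 'cV[R]_m =>
           cl c t z.1 z.2 - delta / 2 * sqnorm z.2)}.

End ConvexData.

(* Main.v *)
Require Import Defs.
From HB Require Import structures.
From mathcomp Require Import all_boot all_order all_algebra.
From mathcomp Require Import all_classical all_reals all_analysis.
From mathcomp Require Import ring lra.

Set Implicit Arguments.
Unset Strict Implicit.
Unset Printing Implicit Defensive.

Import Order.TTheory GRing.Theory Num.Theory.
Import numFieldNormedType.Exports.

Local Open Scope classical_set_scope.
Local Open Scope ring_scope.

(** Both uniqueness statements follow from a comparison principle for the HJB
    equation itself ([classical_solution_le]): two classical solutions with
    bounded Hessian coincide as soon as each of them makes the pre-Hamiltonian
    uniformly convex in the control.  The argument is analytic; it replaces the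
    stochastic verification theorem by the maximum principle.

    Suppose that V1 exceeds V2 somewhere.  Bounded Hessians make V1 - V2 grow at
    most quadratically in x, so that after subtracting a small barrier
    eps * exp(lambda (T - t)) * (1 + |x|^2)^2 a positive maximum is attained,
    at some (t, x) with t < T because V1 = V2 at time T
    ([exists_touching_point]).  At this point the first- and second-order
    derivatives of V1 - V2 are controlled by those of the barrier.  Choose a
    control u that nearly attains the infimum in the Hamiltonian of V2 at
    (t, x).  It is only nearly optimal for V2 and merely admissible for V1, so
    subtracting the two equations gives, up to a small error eta,
      0 <= (V1 - V2)_t + L^u (V1 - V2) + eta,
    where L^u is the second-order operator of the diffusion controlled by u.
    Strong convexity in the control forces |u| <= K (1 + |x|)
    ([near_minimizer_growth]), so the coefficients of L^u grow linearly in x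
    and L^u maps (1 + |x|^2)^2 below a constant multiple of itself.  A large
    lambda then contradicts the inequality.  The control is chosen at a single
    point, so the question of its regularity in (t, x) does not arise.

    Rewriting generator plus pre-Hamiltonian as L^u completes a square in the
    quadratic form of the Hessian, which requires the Hessian to be symmetric:
    this is Schwarz's theorem ([hess_sym]).

    The second statement reduces to the first: convexity of V in x makes its
    Hessian positive semidefinite, and convexity of l - delta/2 |u|^2 bounds
    the Hessian of l in u from below ([convex_strongly_convex_control]). *)

(** * Calculus on the real line *)

Section RealLine.
Context {R : realType}.
Implicit Types (f df : R -> R) (a b s : R).

Lemma is_derive_continuous f df a b :
  (forall s, is_derive s (1 : R) f (df s)) -> {within `[a, b], continuous f}.
Proof.
move=> fdf; apply: derivable_within_continuous => s _.
exact: (@ex_derive _ _ _ _ _ _ _ (fdf s)).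
Qed.

Lemma MVT_dist f df a b : (forall s, is_derive s (1 : R) f (df s)) ->
  exists2 c, `|c - a| <= `|b - a| & f b - f a = df c * (b - a).
Proof.
move=> fdf; have [ab|ba] := leP a b.
  have [c cab ->] := MVT_segment ab (fun s _ => fdf s) (@is_derive_continuous _ _ a b fdf).
  exists c => //; move: cab; rewrite in_itv/= => /andP[ac cb].
  by rewrite !ger0_norm ?subr_ge0// lerD2r.
have [c cab E] := MVT_segment (ltW ba) (fun s _ => fdf s) (@is_derive_continuous _ _ b a fdf).
exists c; last by rewrite -[LHS]opprB E -mulrN opprB.
move: cab; rewrite in_itv/= => /andP[bc ca].
by rewrite !ler0_norm ?subr_le0// ?(ltW ba)// lerN2 lerD2r.
Qed.

(** Taylor with the second derivative bounded below: subtract the parabola and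
    apply the mean value theorem to the remainder and to its derivative. *)
Lemma derive2_ge_taylor f f1 f2 k :
  (forall s, is_derive s (1 : R) f (f1 s)) ->
  (forall s, is_derive s (1 : R) f1 (f2 s)) ->
  (forall s, k <= f2 s) -> f 0 + f1 0 + k / 2 <= f 1.
Proof.
move=> d1 d2 kf.
pose h s := f s - f1 0 * s - k / 2 * s ^+ 2.
have dh s : is_derive s (1 : R) h (f1 s - f1 0 - k * s).
  rewrite /h; apply: is_derive_eq.
  by rewrite /GRing.scale/=; field.
have [c cI E] := MVT ltr01 (fun s _ => dh s) (@is_derive_continuous _ _ 0 1 dh).
move: cI; rewrite in_itv/= => /andP[c0 c1].
have [e _ E2] := MVT_dist 0 c d2.
have := kf e; have : 0 <= (f2 e - k) * c by rewrite mulr_ge0 ?subr_ge0 ?kf// ltW.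
by move: E E2; rewrite /h !subr0 !mulr1 !mulr0 expr0n/= expr1n => E E2; nra.
Qed.

(** If the second derivative at a maximum were positive, the first derivative
    would be positive just to the right of it, and the function would increase. *)
Lemma max_derive2 f f1 l :
  (forall s, is_derive s (1 : R) f (f1 s)) -> is_derive (0 : R) (1 : R) f1 l ->
  (forall s, f s <= f 0) -> f1 0 = 0 /\ l <= 0.
Proof.
move=> d1 d2 fmax.
have f10 : f1 0 = 0.
  have : is_derive (0 : R) (1 : R) f 0.
    have lt0 : -1 < 0 :> R by rewrite oppr_lt0.
    apply: (@derive1_at_max _ f (-1) 1) => //.
    by rewrite in_itv/= lt0 ltr01.
  move=> /@derive_val D0.
  by have := @derive_val _ _ _ _ _ _ _ (d1 0); rewrite D0.
split=> //; rewrite leNgt; apply/negP => l0.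
have /cvgrPdist_lt/(_ _ l0) : (fun h : R => h^-1 *: ((f1 \o shift 0) (h *: (1:R)) - f1 0)) @ 0^' --> l.
  by rewrite -(@derive_val _ _ _ _ _ _ _ d2); exact: (@ex_derive _ _ _ _ _ _ _ d2).
case=> e /= e0 He.
have pos h : 0 < h -> h < e -> 0 < f1 h.
  move=> h0 he.
  have /= := He h; rewrite sub0r normrN gtr0_norm// => /(_ he (lt0r_neq0 h0)).
  rewrite addr0 f10 subr0 {1}/GRing.scale/= {1}/GRing.scale/= mulr1.
  by rewrite ltr_norml => /andP[_]; rewrite gtrBl pmulr_rgt0 ?invr_gt0.
have e20 : 0 < e / 2 by rewrite divr_gt0.
have [c] := MVT e20 (fun s _ => d1 s) (@is_derive_continuous _ _ 0 (e/2) d1).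
rewrite in_itv/= subr0 => /andP[c0 ce] E.
have := fmax (e / 2); rewrite -subr_le0 E leNgt => /negP; apply.
by rewrite mulr_gt0// pos// (lt_trans ce)// ltr_pdivrMr// ltr_pMr// ltr1n.
Qed.

End RealLine.

(** * Euclidean product and the max norm *)

Section Dot.
Context {R : realType}.
Implicit Types n p q : nat.

Lemma dotC n (u v : 'cV[R]_n) : dot u v = dot v u.
Proof. by apply: eq_bigr => i _; rewrite mulrC. Qed.

Lemma dotDl n (u v w : 'cV[R]_n) : dot (u + v) w = dot u w + dot v w.
Proof. by rewrite /dot -big_split; apply: eq_bigr => i _; rewrite mxE mulrDl. Qed.

Lemma dotDr n (u v w : 'cV[R]_n) : dot w (u + v) = dot w u + dot w v.
Proof. by rewrite !(dotC w) dotDl. Qed.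

Lemma dotZl n (a : R) (u v : 'cV[R]_n) : dot (a *: u) v = a * dot u v.
Proof. by rewrite /dot mulr_sumr; apply: eq_bigr => i _; rewrite mxE mulrA. Qed.

Lemma dotZr n (a : R) (u v : 'cV[R]_n) : dot u (a *: v) = a * dot u v.
Proof. by rewrite dotC dotZl dotC. Qed.

Lemma dot0l n (u : 'cV[R]_n) : dot 0 u = 0.
Proof. by rewrite -(scale0r 0) dotZl mul0r. Qed.

Lemma dotNl n (u v : 'cV[R]_n) : dot (- u) v = - dot u v.
Proof. by rewrite -scaleN1r dotZl mulN1r. Qed.

Lemma dotBl n (u v w : 'cV[R]_n) : dot (u - v) w = dot u w - dot v w.
Proof. by rewrite dotDl dotNl. Qed.

Lemma dot_suml n d (u : 'I_d -> 'cV[R]_n) v :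
  dot (\sum_i u i) v = \sum_i dot (u i) v.
Proof.
elim/big_rec2: _ => [|i a b _ <-]; first by rewrite dot0l.
by rewrite dotDl.
Qed.

Lemma dot_mulmx n p (M : 'M[R]_(n, p)) u v :
  dot (M *m u) v = dot u (M^T *m v).
Proof.
rewrite /dot.
under eq_bigr => i _ do rewrite mxE mulr_suml.
rewrite exchange_big /=; apply: eq_bigr => j _.
rewrite mxE mulr_sumr; apply: eq_bigr => i _.
by rewrite !mxE; ring.
Qed.

Lemma sqnorm_ge0 n (u : 'cV[R]_n) : 0 <= sqnorm u.
Proof. by apply: sumr_ge0 => i _; rewrite -expr2 sqr_ge0. Qed.

Lemma mx_entry_le n p (M : 'M[R]_(n, p)) i j : `|M i j| <= `|M|.
Proof.
rewrite [leRHS]/Num.norm/= mx_normrE.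
exact: (le_bigmax _ (fun ij : 'I_n * 'I_p => `|M ij.1 ij.2|) (i, j)).
Qed.

Lemma mx_norm_le n p (M : 'M[R]_(n, p)) k :
  0 <= k -> (forall i j, `|M i j| <= k) -> `|M| <= k.
Proof.
move=> k0 Mk; rewrite [leLHS]/Num.norm/= mx_normrE.
by apply/bigmax_leP; split=> // -[i j] _; exact: Mk.
Qed.

Lemma dot_le n (u v : 'cV[R]_n) : `|dot u v| <= n%:R * `|u| * `|v|.
Proof.
rewrite /dot (le_trans (ler_norm_sum _ _ _))//.
rewrite -mulrA mulr_natl -[X in _ *+ X](card_ord n) -sumr_const.
by apply: ler_sum => i _; rewrite normrM ler_pM// mx_entry_le.
Qed.

Lemma mulmx_norm_le n p q (A : 'M[R]_(n, p)) (B : 'M[R]_(p, q)) :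
  `|A *m B| <= p%:R * `|A| * `|B|.
Proof.
apply: mx_norm_le => [|i j]; first by rewrite !mulr_ge0.
rewrite mxE (le_trans (ler_norm_sum _ _ _))//.
rewrite -mulrA mulr_natl -[X in _ *+ X](card_ord p) -sumr_const.
by apply: ler_sum => k _; rewrite normrM ler_pM// mx_entry_le.
Qed.

Lemma trmx_norm n p (A : 'M[R]_(n, p)) : `|A^T| = `|A|.
Proof.
apply/eqP; rewrite eq_le; apply/andP; split; apply: mx_norm_le => // i j.
  by rewrite mxE mx_entry_le.
by rewrite (le_trans _ (mx_entry_le A^T j i))// mxE.
Qed.

Lemma sqnorm_ge_norm n (u : 'cV[R]_n) : `|u| ^+ 2 <= sqnorm u.
Proof.
rewrite -[leRHS]sqr_sqrtr ?sqnorm_ge0// lerXn2r ?nnegrE ?sqrtr_ge0//.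
apply: mx_norm_le => [|i j]; first by rewrite sqrtr_ge0.
rewrite -sqrtr_sqr ler_wsqrtr// ord1 /sqnorm /dot (bigD1 i)//= -expr2 lerDl.
by apply: sumr_ge0 => k _; rewrite -expr2 sqr_ge0.
Qed.

Lemma sqnorm_le n (u : 'cV[R]_n) : sqnorm u <= n%:R * `|u| ^+ 2.
Proof. by rewrite (le_trans (ler_norm _))// (le_trans (dot_le _ _))// mulrA. Qed.

End Dot.

(** * Derivatives along lines *)

Section Lines.
Context {R : realType}.
Variable n : nat.
Implicit Types (f : 'cV[R]_n -> R) (x v a b : 'cV[R]_n).

Lemma is_derive_line f x v (s : R) : derivable f (x + s *: v) v ->
  is_derive s (1 : R) (fun r => f (x + r *: v)) ('D_v f (x + s *: v)).
Proof.
move=> df.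
have E : (fun h : R => h^-1 *: (((fun r => f (x + r *: v)) \o shift s) (h *: (1 : R))
           - f (x + s *: v)))
  = (fun h : R => h^-1 *: ((f \o shift (x + s *: v)) (h *: v) - f (x + s *: v))).
  apply/funext => h /=; congr (_ *: (f _ - _)).
  by rewrite [_ *: (1 : R)]mulr1 scalerDl addrCA.
by apply: DeriveDef; rewrite /derivable /derive ?E.
Qed.

(** Move from x to x + v one coordinate at a time and apply the one-variable
    mean value theorem to each step: every intermediate point stays within |v|
    of x in the max norm, which is where the hypothesis applies. *)
Lemma increment_le f x v (e : R) : has_grad f ->
  (forall y, `|y - x| <= `|v| -> `|grad f y - grad f x| <= e) ->
  `|f (x + v) - f x - dot (grad f x) v| <= e * \sum_i `|v i ord0|.
Proof.
move=> gf He.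
(* the vector v with only its first k coordinates kept *)
pose w (k : nat) : 'cV[R]_n := \col_i (if (i < k)%N then v i ord0 else 0).
have w0 : w 0%N = 0 by apply/colP => i; rewrite !mxE.
have wn : w n = v by apply/colP => i; rewrite !mxE ltn_ord.
have wS (k : 'I_n) : w k.+1 = w k + v k ord0 *: basis_vec k.
  apply/colP => i; rewrite !mxE ltnS leq_eqVlt eqxx andbT.
  have [->|ik] := eqVneq i k; first by rewrite eqxx ltnn/= mulr1 add0r.
  by rewrite (_ : (i == k :> nat) = false) /= ?mulr0 ?addr0//; exact/negbTE.
have -> : f (x + v) - f x = \sum_(k < n) (f (x + w k.+1) - f (x + w k)).
  rewrite -(big_mkord xpredT (fun k => f (x + w k.+1) - f (x + w k))).
  by rewrite telescope_sumr// wn w0 addr0.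
rewrite /dot -sumrB mulr_sumr (le_trans (ler_norm_sum _ _ _))//.
apply: ler_sum => k _; rewrite wS.
have dk s := @is_derive_line f (x + w k) (basis_vec k) s (gf _ k).
have [s] := MVT_dist 0 (v k ord0) dk.
rewrite !subr0 scale0r addr0 addrA => sv ->.
rewrite -mulrBl normrM ler_wpM2r//.
set z := x + w k + s *: basis_vec k.
have H : `|grad f z - grad f x| <= e.
  apply: He; rewrite /z -[x + w k + _]addrA [x + _]addrC addrK.
  apply: mx_norm_le => // i j; rewrite !mxE (ord1 j) eqxx andbT.
  have [->|ik] := eqVneq i k.
    by rewrite ltnn add0r mulr1 (le_trans sv)// mx_entry_le.
  by rewrite mulr0 addr0; case: ifP => _; rewrite ?normr0// mx_entry_le.
rewrite (le_trans _ H)//.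
by have := mx_entry_le (grad f z - grad f x) k ord0; rewrite !mxE.
Qed.

(** Continuous partial derivatives yield derivatives in every direction: the
    increment estimate bounds the error of the linear approximation. *)
Lemma is_derive_line_grad f x v (s : R) : has_grad f -> continuous (grad f) ->
  is_derive s (1 : R) (fun r => f (x + r *: v)) (dot (grad f (x + s *: v)) v).
Proof.
move=> gf cf; set y := x + s *: v.
set S := \sum_i `|v i ord0|.
have S0 : 0 <= S by apply: sumr_ge0.
suff H : (fun h : R => h^-1 *: (((fun r => f (x + r *: v)) \o shift s) (h *: (1 : R))
           - f (x + s *: v))) @ 0^' --> dot (grad f y) v.
  by apply: DeriveDef; [apply/cvg_ex; exists (dot (grad f y) v) | exact/cvg_lim].
apply/cvgrPdist_le => e e0 /=.
have eS0 : 0 < e / (S + 1) by rewrite divr_gt0// ltr_wpDl.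
have /cvgrPdist_le/(_ _ eS0)/nbhs_ballP[d /= d0 Hd] := cf y.
have dv0 : 0 < d / (`|v| + 1) by rewrite divr_gt0// ltr_wpDl.
exists (d / (`|v| + 1)) => // h /=; rewrite sub0r normrN => hd h0.
rewrite distrC.
have -> : f (x + (h *: (1 : R) + s) *: v) = f (y + h *: v).
  by rewrite [_ *: (1 : R)]mulr1 /y scalerDl [h *: v + _]addrC addrA.
have hvd : `|h *: v| < d.
  rewrite normrZ; rewrite ltr_pdivlMr ?ltr_wpDl// mulrDr mulr1 in hd.
  by apply: le_lt_trans hd; rewrite lerDl.
have I : `|f (y + h *: v) - f y - dot (grad f y) (h *: v)|
         <= e / (S + 1) * \sum_i `|(h *: v) i ord0|.
  apply: increment_le => // z zy; rewrite distrC; apply: Hd.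
  by rewrite -ball_normE/= distrC (le_lt_trans zy).
have -> : h^-1 *: (f (y + h *: v) - f y) - dot (grad f y) v
   = h^-1 * (f (y + h *: v) - f y - dot (grad f y) (h *: v)).
  by rewrite dotZr mulrBr mulrA mulVf// mul1r.
rewrite normrM normfV ler_pdivrMl ?normr_gt0// (le_trans I)//.
have -> : \sum_i `|(h *: v) i ord0| = `|h| * S.
  by rewrite mulr_sumr; apply: eq_bigr => i _; rewrite mxE normrM.
rewrite mulrCA ler_wpM2l// -mulrA ler_piMr ?(ltW e0)//.
by rewrite mulrC ler_pdivrMr ?ltr_wpDl// mul1r lerDl.
Qed.

Lemma grad_mean_value f x v : has_grad f -> continuous (grad f) ->
  exists2 s : R, `|s| <= 1 & f (x + v) - f x = dot (grad f (x + s *: v)) v.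
Proof.
move=> gf cf.
have [s] := MVT_dist 0 1 (fun s => is_derive_line_grad x v s gf cf).
rewrite !subr0 normr1 scale1r scale0r addr0 mulr1 => s1 E.
by exists s.
Qed.

Lemma cvg_dot (T : Type) (F : set_system T) (FF : Filter F) (g : T -> 'cV[R]_n) l v :
  g @ F --> l -> (fun t => dot (g t) v) @ F --> dot l v.
Proof.
move=> gl; rewrite /dot.
have addc : continuous (fun z : R * R => z.1 + z.2) by exact: add_continuous.
apply: (@cvg_big R _ +%R 0 xpredT addc _ F _ (fun i t => g t i ord0 * v i ord0)
  (fun i => l i ord0 * v i ord0)) => i _.
apply: cvgMr_tmp; exact: (cvg_comp _ _ gl (@coord_continuous _ _ _ _ _ _)).
Qed.

End Lines.

Lemma continuous_mulmxl {R : realType} n p q k (F : 'cV[R]_n -> 'M[R]_(p, q))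
    (w : 'M[R]_(q, k)) :
  continuous F -> continuous (fun y => F y *m w).
Proof.
move=> cF y; apply/(@cvgrPdist_lt _ _ _ (nbhs y)) => e e0.
have k0 : 0 < q%:R * `|w| + 1 by rewrite ltr_wpDl// mulr_ge0.
have ek0 : 0 < e / (q%:R * `|w| + 1) by rewrite divr_gt0.
have /cvgrPdist_lt/(_ _ ek0) := cF y.
apply: filterS => z Hz; rewrite -mulmxBl.
rewrite (le_lt_trans (mulmx_norm_le _ _))// mulrAC.
rewrite ltr_pdivlMr// in Hz; apply: le_lt_trans Hz.
by rewrite [leRHS]mulrC ler_wpM2r// lerDl.
Qed.

(** * Second derivatives and the symmetry of the Hessian *)

Section SecondOrder.
Context {R : realType}.
Variable n : nat.
Variable f : 'cV[R]_n -> R.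
Hypotheses (gf : has_grad f) (hf : has_hess f).
Hypotheses (cgf : continuous (grad f)) (chf : continuous (hess f)).
Implicit Types (x v a b : 'cV[R]_n).

Lemma grad_grad x j : grad (fun y => grad f y j ord0) x = col j (hess f x).
Proof. by apply/colP => i; rewrite !mxE. Qed.

Lemma continuous_hess_mul (w : 'cV[R]_n) : continuous (fun y => hess f y *m w).
Proof. by apply: continuous_mulmxl; exact: chf. Qed.

Lemma continuous_grad_coord j : continuous (grad (fun y => grad f y j ord0)).
Proof.
have -> : grad (fun y => grad f y j ord0) = fun y => hess f y *m basis_vec j.
  by apply/funext => y; rewrite grad_grad -colE.
exact: continuous_hess_mul.
Qed.

Lemma is_derive_line_hess x v w (s : R) :
  is_derive s (1 : R) (fun r => dot (grad f (x + r *: v)) w)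
    (dot (hess f (x + s *: v) *m w) v).
Proof.
have D (j : 'I_n) := is_derive_line_grad x v s (@hf j) (@continuous_grad_coord j).
have -> : (fun r => dot (grad f (x + r *: v)) w)
    = \sum_(j < n) (w j ord0 \*o (fun r => grad f (x + r *: v) j ord0)).
  apply/funext => r; rewrite fct_sumE /dot; apply: eq_bigr => j _.
  by rewrite mulrC.
apply: is_derive_eq.
rewrite dot_mulmx; apply: eq_bigr => j _.
rewrite grad_grad; congr (_ * _); rewrite mxE.
by apply: eq_bigr => i _; rewrite !mxE.
Qed.

(** Two mean value theorems, first in the direction a and then in the
    direction b.  The left-hand side is symmetric in a and b; the right-hand
    side is not visibly so, whence the symmetry of the Hessian. *)
Lemma hess_second_difference x a b (s : R) :
  exists p q : R, [/\ `|p| <= `|s|, `|q| <= `|s| &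
    f (x + s *: a + s *: b) - f (x + s *: a) - (f (x + s *: b) - f x)
    = s ^+ 2 * dot (hess f (x + p *: a + q *: b) *m a) b].
Proof.
pose k r := f (x + s *: b + r *: a) - f (x + r *: a).
have dk r : is_derive r (1 : R) k
    (dot (grad f (x + s *: b + r *: a)) a - dot (grad f (x + r *: a)) a).
  have d1 := is_derive_line_grad (x + s *: b) a r gf cgf.
  have d2 := is_derive_line_grad x a r gf cgf.
  exact: is_deriveB.
have [p] := MVT_dist 0 s dk; rewrite !subr0 => ps E.
have [q] := MVT_dist 0 s (is_derive_line_hess (x + p *: a) b a).
rewrite !subr0 scale0r addr0 => qs E'.
exists p, q; split => //; move: E.
rewrite /k scale0r !addr0 [x + s *: b + _]addrAC => ->.
by rewrite [x + s *: b + _]addrAC E'; ring.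
Qed.

(** Schwarz's theorem: compare the two expressions of one second difference and
    let its step tend to zero. *)
Lemma hess_sym x a b : dot (hess f x *m a) b = dot (hess f x *m b) a.
Proof.
apply/eqP; rewrite -subr_eq0 -normr_le0; apply/ler_addgt0Pr => e e0.
rewrite add0r; have e20 : 0 < e / 2 by rewrite divr_gt0.
have C c d : exists2 r : R, 0 < r & forall y, `|y - x| < r ->
    `|dot (hess f x *m c) d - dot (hess f y *m c) d| < e / 2.
  have /cvgrPdist_lt/(_ _ e20)/nbhs_ballP[r /= r0 Hr] :
      dot (hess f y *m c) d @[y --> x] --> dot (hess f x *m c) d.
    by apply: (@cvg_dot _ _ _ (nbhs x)); exact: (@continuous_hess_mul c x).
  exists r => // y yx; apply: Hr.
  by rewrite -ball_normE/= distrC.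
have [r1 r10 H1] := C a b; have [r2 r20 H2] := C b a.
pose K := `|a| + `|b| + 1; have K0 : 0 < K by rewrite ltr_wpDl// addr_ge0.
pose r := Num.min r1 r2; have r0 : 0 < r by rewrite lt_min r10.
(* a step so small that both mean value points fall within r of x *)
pose s := r / K; have s0 : 0 < s by rewrite divr_gt0.
have near c d : `|c| + `|d| = `|a| + `|b| -> exists2 z, `|z - x| < r &
    f (x + s *: c + s *: d) - f (x + s *: c) - (f (x + s *: d) - f x)
    = s ^+ 2 * dot (hess f z *m c) d.
  move=> cd; have [p [q [ps qs E]]] := hess_second_difference x c d s.
  exists (x + p *: c + q *: d) => //.
  rewrite -[x + p *: c + _]addrA [x + _]addrC addrK.
  rewrite (le_lt_trans (ler_normD _ _))// !normrZ.
  rewrite (@le_lt_trans _ _ (s * (`|c| + `|d|)))//.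
    by rewrite mulrDr lerD// ler_wpM2r// -(gtr0_norm s0).
  rewrite cd /s -mulrA gtr_pMr// mulrC ltr_pdivrMr// mul1r.
  by rewrite ltrDl.
have [z zx E1] := near a b erefl.
have [z' zx' E2] := near b a (addrC _ _).
have E : dot (hess f z *m a) b = dot (hess f z' *m b) a.
  have s20 : s ^+ 2 != 0 by rewrite expf_neq0// gt_eqF.
  by apply: (mulfI s20); rewrite -E1 -E2 [x + s *: b + _]addrAC; ring.
have L1 : `|z - x| < r1 by apply: lt_le_trans zx _; rewrite ge_min lexx.
have L2 : `|z' - x| < r2 by apply: lt_le_trans zx' _; rewrite ge_min lexx orbT.
have {}L1 := H1 _ L1; have {}L2 := H2 _ L2.
have close (p q u u' k : R) : u = u' -> `|p - u| < k -> `|q - u'| < k ->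
    `|p - q| <= k + k.
  move=> <- pu qu; rewrite -(subrKA u) (le_trans (ler_normD _ _))//.
  by rewrite lerD ?ltW// distrC.
by rewrite [leRHS]splitr; exact: close E L1 L2.
Qed.

Lemma taylor2_ge x u k :
  (forall y, k <= dot (hess f y *m u) u) ->
  f x + dot (grad f x) u + k / 2 <= f (x + u).
Proof.
move=> Hk.
have := derive2_ge_taylor (fun s => is_derive_line_grad x u s gf cgf)
  (fun s => is_derive_line_hess x u u s) (fun s => Hk _).
by rewrite scale1r scale0r addr0.
Qed.

(** The function k s^2 - f (x + s v) - f (x - s v) is maximal at s = 0, so its
    second derivative 2 k - 2 <f''(x) v, v> is nonpositive there. *)
Lemma second_difference_hess_ge x v k :
  (forall s : R, k * s ^+ 2 <= f (x + s *: v) + f (x - s *: v) - f x *+ 2) ->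
  k <= dot (hess f x *m v) v.
Proof.
move=> Hk.
pose h s := k * s ^+ 2 - f (x + s *: v) - f (x + s *: - v).
pose h1 s := k * (s *+ 2) - dot (grad f (x + s *: v)) v - dot (grad f (x + s *: - v)) (- v).
have d1 s : is_derive s (1 : R) h (h1 s).
  have e1 := is_derive_line_grad x v s gf cgf.
  have e2 := is_derive_line_grad x (- v) s gf cgf.
  by rewrite /h; apply: is_derive_eq; rewrite /h1 /GRing.scale/=; ring.
have d2 : is_derive (0 : R) (1 : R) h1 (k *+ 2 - dot (hess f x *m v) v *+ 2).
  have := is_derive_line_hess x v v 0; have := is_derive_line_hess x (- v) (- v) 0.
  rewrite !scale0r !addr0 => e1 e2; rewrite /h1; apply: is_derive_eq.
  by rewrite mulmxN dotNl (dotC _ (- v)) dotNl dotC /GRing.scale/=; ring.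
have [] := max_derive2 d1 d2.
  move=> s; rewrite /h !scale0r !addr0 expr0n/= mulr0 sub0r.
  have := Hk s; rewrite scalerN; lra.
by move=> _; rewrite -mulrnBl pmulrn_lle0// subr_le0.
Qed.

End SecondOrder.

(** * Continuity and compactness on the time strip *)

Section TimeStrip.
Context {R : realType}.

Lemma continuous_pair (E F G : topologicalType) (f : E -> F) (g : E -> G) :
  continuous f -> continuous g -> continuous (fun x => (f x, g x)).
Proof.
move=> cf cg x.
apply: (@cvg_pair E F G (nbhs x) (nbhs (f x)) (nbhs (g x)) _ _ _ f g).
- exact: cf.
- exact: cg.
Qed.

Lemma within_continuous_slice (E F G : topologicalType) (B : set E) (A : set F)
    (f : F -> G) (phi : E -> F) :
  {within A, continuous f} -> continuous phi -> (forall e, B e -> A (phi e)) ->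
  {within B, continuous (f \o phi)}.
Proof.
move=> /subspace_continuousP cf cphi BA; apply/subspace_continuousP => x Bx.
apply: (@cvg_comp _ _ _ phi f (within B (nbhs x)) (within A (nbhs (phi x)))).
  move=> U /= /cphi; rewrite /within/= !nbhs_simpl/=; apply: filterS => z AU Bz.
  by apply: AU; exact: BA.
by apply: cf; exact: BA.
Qed.

Variable T : R.

Lemma cont_tx_space n (E : topologicalType) (f : R -> 'cV[R]_n -> E) t :
  cont_tx T f -> t \in `[0, T] -> continuous (f t).
Proof.
move=> cf tT; apply/continuous_subspace_setT.
apply: (@within_continuous_slice _ _ _ setT _ _ (fun x => (t, x)) cf) => //.
exact: (continuous_pair (@cst_continuous _ _ t) (fun y => cvg_id)).
Qed.

Lemma cont_tx_time n (E : topologicalType) (f : R -> 'cV[R]_n -> E) x :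
  cont_tx T f -> cont_t T (f ^~ x).
Proof.
move=> cf.
apply: (@within_continuous_slice _ _ _ `[0, T] _ _ (fun t => (t, x)) cf) => //.
exact: (continuous_pair (fun y => cvg_id) (@cst_continuous _ _ x)).
Qed.

Lemma cont_txu_state n m (E : topologicalType)
    (f : R -> 'cV[R]_n -> 'cV[R]_m -> E) u :
  cont_txu T f -> cont_tx T (fun t x => f t x u).
Proof.
move=> cf.
apply: (@within_continuous_slice _ _ _ _ _ _
  (fun z : R * 'cV[R]_n => (z, u)) cf) => //.
exact: (continuous_pair (fun y => cvg_id) (@cst_continuous _ _ u)).
Qed.

Lemma cont_txu_control n m (E : topologicalType)
    (f : R -> 'cV[R]_n -> 'cV[R]_m -> E) x :
  cont_txu T f -> cont_tx T (fun t u => f t x u).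
Proof.
move=> cf.
apply: (@within_continuous_slice _ _ _ _ _ _
  (fun z : R * 'cV[R]_m => (z.1, x, z.2)) cf) => //.
  apply: continuous_pair; last by move=> z; exact: cvg_snd.
  by apply: continuous_pair; [move=> z; exact: cvg_fst|exact: cst_continuous].
Qed.

Lemma cont_t_bounded (V : normedModType R) (f : R -> V) : cont_t T f ->
  exists2 K : R, 0 <= K & forall t, t \in `[0, T] -> `|f t| <= K.
Proof.
move=> cf.
have /compact_bounded[M [_ HM]] : compact (f @` `[0, T]).
  by apply: continuous_compact => //; exact: segment_compact.
exists (`|M| + 1) => [|t tT]; first by rewrite addr_ge0.
apply: (HM (`|M| + 1)); last by exists t.
by rewrite (le_lt_trans (ler_norm _))// ltrDl.
Qed.

End TimeStrip.

Section Compactness.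
Context {R : realType}.

Lemma closed_ball_compact n (r : R) : 0 <= r -> compact [set x : 'cV[R]_n | `|x| <= r].
Proof.
move=> r0.
have -> : [set x : 'cV[R]_n | `|x| <= r]
    = trmx @` [set x : 'rV[R]_n | forall i, `[- r, r]%classic (x ord0 i)].
  apply/seteqP; split=> [x /= xr|_ /= [x xr] <-].
    exists x^T; last by rewrite trmxK.
    by move=> i; rewrite mxE /= in_itv/= -ler_norml (le_trans (mx_entry_le _ _ _)).
  apply: mx_norm_le => // i j; rewrite mxE (ord1 j).
  by have := xr i; rewrite /= in_itv/= -ler_norml.
apply: continuous_compact; last first.
  by apply: (@rV_compact R n (fun=> `[- r, r]%classic)) => i; exact: segment_compact.
apply: continuous_subspaceT => x.
apply/(@cvgrPdist_lt _ _ _ (nbhs x)) => e e0.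
have /cvgrPdist_lt/(_ _ e0) : (id : 'rV[R]_n -> 'rV[R]_n) @ x --> x by exact: cvg_id.
by apply: filterS => y; rewrite -trmx_norm linearB.
Qed.

Lemma strip_max n (T r : R) (f : R -> 'cV[R]_n -> R) : 0 <= T -> 0 <= r ->
  cont_tx T f ->
  exists t x, [/\ t \in `[0, T], `|x| <= r &
    forall s y, s \in `[0, T] -> `|y| <= r -> f s y <= f t x].
Proof.
move=> T0 r0 cf; pose A : set (R * 'cV[R]_n) := `[0, T] `*` [set x | `|x| <= r].
have cA : compact A.
  by apply: compact_setX; [exact: segment_compact|exact: closed_ball_compact].
have A0 : A !=set0.
  by exists (0, 0); split => /=; rewrite ?normr0// in_itv/= lexx.
have cfA : {within A, continuous (fun z : R * 'cV[R]_n => f z.1 z.2)}.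
  by apply: continuous_subspaceW cf => z [].
have [[t x]] := compact_EVT_max A0 cA cfA.
rewrite inE => -[/= tT xr] H; exists t, x; split=> // s y sT yr.
by apply: (H (s, y)); rewrite inE.
Qed.

End Compactness.

(** * Growth of functions with bounded Hessian *)

Section Growth.
Context {R : realType}.
Variables (n : nat) (f : 'cV[R]_n -> R) (K : R).
Hypotheses (gf : has_grad f) (hf : has_hess f).
Hypotheses (cgf : continuous (grad f)) (chf : continuous (hess f)).
Hypothesis hK : forall x, `|hess f x| <= K.

Lemma grad_growth x : `|grad f x - grad f 0| <= n%:R * K * `|x|.
Proof.
have K0 : 0 <= K by apply: le_trans (hK 0).
apply: mx_norm_le => [|j i]; first by rewrite !mulr_ge0.
have [s _] := grad_mean_value 0 x (@hf j) (@continuous_grad_coord _ _ _ chf j).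
rewrite !add0r (ord1 i) => E.
have -> : (grad f x - grad f 0) j ord0 = grad f x j ord0 - grad f 0 j ord0.
  by rewrite mxE [X in _ + X]mxE.
rewrite E (le_trans (dot_le _ _))// ler_wpM2r// ler_wpM2l//.
apply: mx_norm_le => // k l; rewrite grad_grad [X in `|X|]mxE.
exact: le_trans (mx_entry_le _ _ _) (hK _).
Qed.

Lemma value_growth x :
  `|f x - f 0| <= n%:R * (`|grad f 0| + n%:R * K * `|x|) * `|x|.
Proof.
have K0 : 0 <= K by apply: le_trans (hK 0).
have [s s1] := grad_mean_value 0 x gf cgf; rewrite !add0r => ->.
rewrite (le_trans (dot_le _ _))// ler_wpM2r// ler_wpM2l//.
rewrite -[X in `|X| <= _](subrK (grad f 0)) addrC (le_trans (ler_normD _ _))// lerD2l.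
rewrite (le_trans (grad_growth _))// normrZ ler_wpM2l ?mulr_ge0//.
by rewrite ler_piMl.
Qed.

End Growth.

(** * Touching by a barrier *)

Section Touching.
Context {R : realType}.

Lemma sqnorm_line n (x v : 'cV[R]_n) (s : R) :
  sqnorm (x + s *: v) = sqnorm x + s * (dot x v *+ 2) + s ^+ 2 * sqnorm v.
Proof. by rewrite /sqnorm dotDl !dotDr !dotZl !dotZr (dotC v x); ring. Qed.

Lemma continuous_sqnorm n : continuous (@sqnorm R n).
Proof.
move=> x; rewrite /sqnorm /dot.
have addc : continuous (fun z : R * R => z.1 + z.2) by exact: add_continuous.
apply: (@cvg_big R _ +%R 0 xpredT addc _ (nbhs x) _
  (fun i (y : 'cV[R]_n) => y i ord0 * y i ord0) (fun i => x i ord0 * x i ord0)) => i _.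
by apply: cvgM; exact: coord_continuous.
Qed.

(** The fourth-order growth in x dominates the quadratic growth of solutions; the
    rate lambda absorbs the action of the diffusion operator. *)
Definition barrier n (T lambda eps : R) (t : R) (x : 'cV[R]_n) : R :=
  eps * expR (lambda * (T - t)) * (1 + sqnorm x) ^+ 2.

Lemma continuous_barrier n T lambda eps :
  continuous (fun z : R * 'cV[R]_n => barrier T lambda eps z.1 z.2).
Proof.
have smooth (f : R -> R) : (forall s, derivable f s 1) -> continuous f.
  by move=> df s; exact/differentiable_continuous/derivable1_diffP/df.
have cA : continuous (fun s : R => eps * expR (lambda * (T - s))).
  by apply: smooth => s; exact: ex_derive.
have cB : continuous (fun s : R => (1 + s) ^+ 2).
  by apply: smooth => s; exact: ex_derive.
move=> z; apply: (@cvgM _ _ (nbhs z) _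
  (fun y => eps * expR (lambda * (T - y.1))) (fun y => (1 + sqnorm y.2) ^+ 2)).
  apply: (@cvg_comp _ _ _ (fun y : R * 'cV[R]_n => y.1)
    (fun s : R => eps * expR (lambda * (T - s))) (nbhs z) (nbhs z.1)).
    exact: cvg_fst.
  exact: (cA z.1).
apply: (@cvg_comp _ _ _ (fun y : R * 'cV[R]_n => sqnorm y.2) (fun s : R => (1 + s) ^+ 2)
  (nbhs z) (nbhs (sqnorm z.2))); last exact: (cB (sqnorm z.2)).
apply: (@cvg_comp _ _ _ (fun y : R * 'cV[R]_n => y.2) (@sqnorm R n)
  (nbhs z) (nbhs z.2)); first exact: cvg_snd.
exact: (@continuous_sqnorm n z.2).
Qed.

(** Only the difference quotients from the right are used, so that t = 0 is
    allowed; they are nonpositive at a maximum. *)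
Lemma time_derivative_max T n (V1 V2 : R -> 'cV[R]_n -> R) lambda eps t x :
  t \in `[0, T] -> t < T ->
  time_derivable T V1 t x -> time_derivable T V2 t x ->
  (forall s, s \in `[0, T] -> V1 s x - V2 s x - barrier T lambda eps s x
     <= V1 t x - V2 t x - barrier T lambda eps t x) ->
  Dt T V1 t x - Dt T V2 t x <= - lambda * barrier T lambda eps t x.
Proof.
move=> tT ltT d1 d2 tmax.
have right : t^'+ `=>` within `[0, T] t^'.
  move: tT; rewrite in_itv/= => /andP[t0 _].
  move=> A [e /= e0 He]; exists (Num.min e (T - t)) => /=.
    by rewrite lt_min e0 subr_gt0.
  move=> s /=; rewrite lt_min => /andP[se sT] ts; apply: He => //.
    by rewrite gt_eqF.
  rewrite /= in_itv/= (le_trans t0 (ltW ts))/=.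
  rewrite distrC gtr0_norm ?subr_gt0// in sT.
  by move: sT; rewrite ltrD2r => /ltW.
have c1 : (s - t)^-1 * (V1 s x - V1 t x) @[s --> t^'+] --> Dt T V1 t x.
  exact: cvg_trans (cvg_fmap2 right) d1.
have c2 : (s - t)^-1 * (V2 s x - V2 t x) @[s --> t^'+] --> Dt T V2 t x.
  exact: cvg_trans (cvg_fmap2 right) d2.
pose b s := barrier T lambda eps s x.
have db : is_derive t (1 : R) b (- lambda * b t).
  by rewrite /b /barrier; apply: is_derive_eq; rewrite /GRing.scale/=; ring.
have c3 : (s - t)^-1 * (b s - b t) @[s --> t^'+] --> - lambda * b t.
  apply/cvgrPdist_lt => e e0.
  have /cvgrPdist_lt/(_ _ e0)[r /= r0 Hr] :
      (fun h : R => h^-1 *: ((b \o shift t) (h *: (1 : R)) - b t)) @ 0^' --> - lambda * b t.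
    by rewrite -(@derive_val _ _ _ _ _ _ _ db); exact: (@ex_derive _ _ _ _ _ _ _ db).
  exists r => // s /= st ts.
  have /= := Hr (s - t); rewrite sub0r normrN (distrC s) => /(_ st).
  by rewrite subr_eq0 gt_eqF// [_%:A]mulr1 subrK; exact.
have c : (s - t)^-1 * (V1 s x - V1 t x) - (s - t)^-1 * (V2 s x - V2 t x)
   - (s - t)^-1 * (b s - b t) @[s --> t^'+] --> Dt T V1 t x - Dt T V2 t x - - lambda * b t.
  by apply: cvgB => //; apply: cvgB.
rewrite -subr_le0; apply: (cvgr_to_le c).
near=> s.
rewrite -!mulrBr; apply: mulr_ge0_le0.
  by rewrite invr_ge0 subr_ge0 ltW//; near: s; exact: nbhs_right_gt.
have : V1 s x - V2 s x - b s <= V1 t x - V2 t x - b t.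
  apply: tmax; rewrite in_itv/=; apply/andP; split.
    move: tT; rewrite in_itv/= => /andP[t0 _]; apply: (le_trans t0).
    by rewrite ltW//; near: s; exact: nbhs_right_gt.
  by rewrite ltW//; near: s; exact: nbhs_right_lt.
lra.
Unshelve. all: by end_near. Qed.

(** The barrier restricted to a line through the touching point is the square of
    a quadratic polynomial: with al = <x, v> and be = |v|^2 one has
    1 + |x + s v|^2 = q + 2 s al + s^2 be. *)
Lemma quartic_contact (f f1 : R -> R) l k q al be :
  (forall s, is_derive s (1 : R) f (f1 s)) -> is_derive (0 : R) (1 : R) f1 l ->
  (forall s, f s - k * (q + s * (al *+ 2) + s ^+ 2 * be) ^+ 2 <= f 0 - k * q ^+ 2) ->
  f1 0 = k * (4 * q * al) /\ l <= k * (4 * q * be + 8 * al ^+ 2).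
Proof.
move=> d1 d2 fmax.
pose h s := f s - k * (q + s * (al *+ 2) + s ^+ 2 * be) ^+ 2.
pose dh s := f1 s
  - k * (2 * (q + s * (al *+ 2) + s ^+ 2 * be) * (al *+ 2 + s * (be *+ 2))).
have e1 s : is_derive s (1 : R) h (dh s).
  have e := d1 s.
  by rewrite /h; apply: is_derive_eq; rewrite /dh /GRing.scale/=; ring.
have e2 : is_derive (0 : R) (1 : R) dh (l - k * (4 * q * be + 8 * al ^+ 2)).
  by rewrite /dh; apply: is_derive_eq; rewrite /GRing.scale/=; ring.
have [] := max_derive2 e1 e2.
  by move=> s; apply: le_trans (fmax s) _; rewrite /h expr0n/= !mul0r !addr0.
by rewrite /dh !mul0r !addr0 => E1 E2; split; lra.
Qed.

Lemma space_derivatives_max T n (V1 V2 : R -> 'cV[R]_n -> R) k t x :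
  t \in `[0, T] -> C12 T V1 -> C12 T V2 ->
  (forall y, V1 t y - V2 t y - k * (1 + sqnorm y) ^+ 2
     <= V1 t x - V2 t x - k * (1 + sqnorm x) ^+ 2) -> forall v,
  dot (grad (V1 t) x - grad (V2 t) x) v = k * (4 * (1 + sqnorm x) * dot x v)
  /\ dot ((hess (V1 t) x - hess (V2 t) x) *m v) v
     <= k * (4 * (1 + sqnorm x) * sqnorm v + 8 * dot x v ^+ 2).
Proof.
move=> tT [_ /(_ _ tT) g1 /(_ _ tT) h1 _ [cg1 ch1]].
move=> [_ /(_ _ tT) g2 /(_ _ tT) h2 _ [cg2 ch2]] xmax v.
have {}cg1 := cont_tx_space cg1 tT; have {}cg2 := cont_tx_space cg2 tT.
have {}ch1 := cont_tx_space ch1 tT; have {}ch2 := cont_tx_space ch2 tT.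
pose f s := V1 t (x + s *: v) - V2 t (x + s *: v).
pose df s := dot (grad (V1 t) (x + s *: v)) v - dot (grad (V2 t) (x + s *: v)) v.
have d1 s : is_derive s (1 : R) f (df s).
  exact: (is_deriveB (is_derive_line_grad x v s g1 cg1)
                     (is_derive_line_grad x v s g2 cg2)).
have d2 := is_deriveB (is_derive_line_hess h1 ch1 x v v 0)
                      (is_derive_line_hess h2 ch2 x v v 0).
have [] := quartic_contact d1 d2 (k := k) (q := 1 + sqnorm x) (al := dot x v)
  (be := sqnorm v).
  move=> s; have := xmax (x + s *: v).
  by rewrite /f sqnorm_line !addrA scale0r addr0.
by rewrite /df scale0r addr0 mulmxBl !dotBl.
Qed.

End Touching.

Section TouchingPoint.
Context {R : realType}.

(** The maximum over the whole strip exists because the difference minus the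
    barrier is negative outside a ball and positive at (t', x'). *)
Lemma exists_touching_point n (T lambda K : R) (V1 V2 : R -> 'cV[R]_n -> R) :
  0 < T -> 0 <= lambda -> C12 T V1 -> C12 T V2 ->
  (forall t x, t \in `[0, T] -> V1 t x - V2 t x <= K * (1 + sqnorm x)) ->
  (forall x, V1 T x <= V2 T x) ->
  forall t' x', t' \in `[0, T] -> V2 t' x' < V1 t' x' ->
  exists k t x, [/\ 0 < k, t \in `[0, T],
    Dt T V1 t x - Dt T V2 t x <= - lambda * (k * (1 + sqnorm x) ^+ 2) &
    forall v, dot (grad (V1 t) x - grad (V2 t) x) v
        = k * (4 * (1 + sqnorm x) * dot x v)
      /\ dot ((hess (V1 t) x - hess (V2 t) x) *m v) v
        <= k * (4 * (1 + sqnorm x) * sqnorm v + 8 * dot x v ^+ 2)].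
Proof.
move=> T0 l0 C1 C2 growth fin t' x' t'T V12.
pose q (x : 'cV[R]_n) := 1 + sqnorm x.
have q1 x : 1 <= q x by rewrite lerDl sqnorm_ge0.
have q0 x : 0 < q x by apply: lt_le_trans (q1 x).
pose a t := expR (lambda * (T - t)).
have a1 t : t \in `[0, T] -> 1 <= a t.
  rewrite in_itv/= => /andP[_ tT]; rewrite /a -expR0 ler_expR.
  by rewrite mulr_ge0// subr_ge0.
pose gap := V1 t' x' - V2 t' x'; have gap0 : 0 < gap by rewrite subr_gt0.
(* the barrier takes half the value of the gap at (t', x') *)
pose eps := gap / (2 * (a t' * q x' ^+ 2)).
have aq0 : 0 < a t' * q x' ^+ 2 by rewrite mulr_gt0 ?exprn_gt0 ?expR_gt0.
have eps0 : 0 < eps by rewrite divr_gt0// mulr_gt0.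
pose psi t x := V1 t x - V2 t x - barrier T lambda eps t x.
have psi' : 0 < psi t' x'.
  rewrite /psi /barrier -/(a t') -/(q x') -/gap -mulrA /eps invfM [gap * _]mulrA.
  rewrite divfK ?gt_eqF//.
  by rewrite subr_gt0 ltr_pdivrMr// ltr_pMr// ltr1n.
(* outside this radius 1 + |x|^2 exceeds K / eps, and the ball contains x' *)
pose r := `|x'| + 1 + `|K| / eps.
have Ke0 : 0 <= `|K| / eps by rewrite divr_ge0// ltW.
have r0 : 0 <= r by rewrite !addr_ge0.
have out t x : t \in `[0, T] -> r < `|x| -> psi t x < 0.
  move=> tT rx.
  have rq : `|K| / eps < q x.
    have x1 : 1 <= `|x|.
      by apply: le_trans (ltW rx); rewrite /r -addrA addrCA lerDl addr_ge0.
    rewrite (@lt_le_trans _ _ `|x|)//.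
      by apply: le_lt_trans rx; rewrite /r lerDr addr_ge0.
    rewrite (le_trans _ (ler_wpDl ler01 (sqnorm_ge_norm x)))// expr2.
    by rewrite ler_peMl.
  rewrite subr_lt0 (le_lt_trans (growth _ _ tT))// -/(q x).
  rewrite (@le_lt_trans _ _ (`|K| * q x)) ?ler_wpM2r ?ler_norm ?ltW//.
  rewrite /barrier -/(a t) -/(q x) expr2 mulrA ltr_pM2r//.
  rewrite ltr_pdivrMr// mulrC in rq; apply: (lt_le_trans rq).
  by rewrite ler_pM2r// ler_peMr ?a1// ltW.
have cpsi : cont_tx T psi.
  case: C1 => _ _ _ [c1 _] _; case: C2 => _ _ _ [c2 _] _.
  have c3 : {within `[0, T] `*` setT, continuous (fun z : R * 'cV[R]_n =>
      barrier T lambda eps z.1 z.2)}.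
    exact/continuous_subspaceT/continuous_barrier.
  exact: within_continuousB (within_continuousB c1 c2) c3.
have [t [x [tT xr M]]] := strip_max (ltW T0) r0 cpsi.
have psi0 : 0 < psi t x.
  apply: lt_le_trans psi' _; apply: M => //.
  by rewrite /r -addrA lerDl addr_ge0.
have {M}M s y : s \in `[0, T] -> psi s y <= psi t x.
  move=> sT; have [yr|yr] := leP `|y| r; first exact: M.
  exact/ltW/(lt_trans (out _ _ sT yr)).
have ltT : t < T.
  move: (tT); rewrite in_itv/= => /andP[_]; rewrite le_eqVlt => /predU1P[tE|//].
  move: psi0; rewrite ltNge /psi tE; apply: contraNT => _.
  rewrite subr_le0 (@le_trans _ _ 0) ?subr_le0//.
  by apply: mulr_ge0; [rewrite mulr_ge0 ?expR_ge0// ltW|exact: exprn_ge0 (ltW (q0 x))].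
exists (eps * a t), t, x; split => //.
- by rewrite mulr_gt0// expR_gt0.
- case: C1 => d1 _ _ _ _; case: C2 => d2 _ _ _ _.
  exact: time_derivative_max (d1 _ _ tT) (d2 _ _ tT) (fun s sT => M s x sT).
- exact: space_derivatives_max C1 C2 (fun y => M t y tT).
Qed.

End TouchingPoint.

(** * Polynomial growth in space, uniformly in time *)

Section PolynomialGrowth.
Context {R : realType}.
Variables (T : R) (n : nat).

Definition grows (k : nat) p q (f : R -> 'cV[R]_n -> 'M[R]_(p, q)) : Prop :=
  exists2 K : R, 0 <= K & forall t x, t \in `[0, T] -> `|f t x| <= K * (1 + `|x|) ^+ k.

Lemma growsD k p q (f g : R -> 'cV[R]_n -> 'M[R]_(p, q)) :
  grows k f -> grows k g -> grows k (fun t x => f t x + g t x).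
Proof.
move=> [K K0 Kf] [L L0 Lg]; exists (K + L) => [|t x tT]; first exact: addr_ge0.
by rewrite mulrDl (le_trans (ler_normD _ _))// lerD ?Kf ?Lg.
Qed.

Lemma grows0 k p q : grows k (fun _ _ => 0 : 'M[R]_(p, q)).
Proof. by exists 0 => // t x _; rewrite normr0 mul0r. Qed.

Lemma grows_sum k p q d (f : 'I_d -> R -> 'cV[R]_n -> 'M[R]_(p, q)) :
  (forall i, grows k (f i)) -> grows k (fun t x => \sum_i f i t x).
Proof.
move=> fk; have -> : (fun t x => \sum_i f i t x) = \sum_i f i.
  by apply/funext => t; apply/funext => x; rewrite !fct_sumE.
by elim/big_ind: _ => [|a b|i _]; [exact: grows0|exact: growsD|exact: fk].
Qed.

Lemma growsM k l p q r (f : R -> 'cV[R]_n -> 'M[R]_(p, q))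
    (g : R -> 'cV[R]_n -> 'M[R]_(q, r)) :
  grows k f -> grows l g -> grows (k + l) (fun t x => f t x *m g t x).
Proof.
move=> [K K0 Kf] [L L0 Lg]; exists (q%:R * K * L) => [|t x tT].
  by rewrite !mulr_ge0.
rewrite exprD mulrACA -[_ * K * _]mulrA (le_trans (mulmx_norm_le _ _))//.
by rewrite ler_pM ?mulr_ge0 ?Lg// ler_wpM2l ?Kf.
Qed.

Lemma growsT k p q (f : R -> 'cV[R]_n -> 'M[R]_(p, q)) :
  grows k f -> grows k (fun t x => (f t x)^T).
Proof. by move=> [K K0 Kf]; exists K => // t x tT; rewrite trmx_norm Kf. Qed.

Lemma grows_le k l p q (f : R -> 'cV[R]_n -> 'M[R]_(p, q)) :
  (k <= l)%N -> grows k f -> grows l f.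
Proof.
move=> kl [K K0 Kf]; exists K => // t x tT; apply: (le_trans (Kf _ _ tT)).
by rewrite ler_wpM2l// ler_weXn2l// lerDl.
Qed.

Lemma grows_id : grows 1 (fun _ (x : 'cV[R]_n) => x).
Proof. by exists 1 => // t x _; rewrite mul1r lerDr. Qed.

Lemma grows_time p q (f : R -> 'M[R]_(p, q)) : cont_t T f -> grows 0 (fun t _ => f t).
Proof.
move=> /cont_t_bounded[K K0 Kf]; exists K => // t x tT.
by rewrite expr0 mulr1 Kf.
Qed.

Lemma grows_bounded p q (f : R -> 'cV[R]_n -> 'M[R]_(p, q)) K :
  (forall t x, t \in `[0, T] -> `|f t x| <= K) -> grows 0 f.
Proof.
move=> Kf; exists `|K| => // t x tT; rewrite expr0 mulr1.
exact: le_trans (Kf _ _ tT) (ler_norm _).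
Qed.

End PolynomialGrowth.

(** * Growth of solutions and of nearly optimal controls *)

Section Solutions.
Context {R : realType}.
Variables (T : R) (n : nat).

Lemma grows_grad (V : R -> 'cV[R]_n -> R) :
  C12 T V -> bounded_hess T V -> grows T 1 (fun t => grad (V t)).
Proof.
move=> [_ gV hV _ [cg ch]] [K Kh].
have [L L0 Lg] := cont_t_bounded (cont_tx_time (x := 0) cg).
exists (L + n%:R * `|K|) => [|t x tT]; first by rewrite addr_ge0// mulr_ge0.
have K' y : `|hess (V t) y| <= `|K| by apply: le_trans (Kh _ _ tT) (ler_norm _).
have := grad_growth (hV _ tT) (cont_tx_space ch tT) K' x.
have := Lg _ tT.
have := ler_normD (grad (V t) 0) (grad (V t) x - grad (V t) 0).
rewrite [grad (V t) 0 + _]addrC subrK expr1 => a1 a2 a3.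
have : 0 <= L * `|x| by rewrite mulr_ge0.
have : 0 <= n%:R * `|K| by rewrite mulr_ge0.
nra.
Qed.

Lemma value_quadratic_growth (V : R -> 'cV[R]_n -> R) :
  C12 T V -> bounded_hess T V -> exists2 K : R, 0 <= K &
    forall t x, t \in `[0, T] -> `|V t x| <= K * (1 + sqnorm x).
Proof.
move=> [_ gV hV [cV _] [cg ch]] [K Kh].
have [M M0 MV] := cont_t_bounded (cont_tx_time (x := 0) cV).
have [L L0 Lg] := cont_t_bounded (cont_tx_time (x := 0) cg).
pose N : R := n%:R; have N0 : 0 <= N by [].
exists (M + N * (L + N * `|K|)) => [|t x tT].
  by rewrite addr_ge0// mulr_ge0// addr_ge0// mulr_ge0.
have K' y : `|hess (V t) y| <= `|K| by apply: le_trans (Kh _ _ tT) (ler_norm _).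
have := value_growth (gV _ tT) (hV _ tT) (cont_tx_space cg tT) (cont_tx_space ch tT) K' x.
have := ler_normD (V t 0) (V t x - V t 0); rewrite addrC subrK -/N.
have := MV _ tT; have := Lg _ tT; have := sqnorm_ge_norm x.
set a := `|V t x|; set y := `|x|; set s := sqnorm x; set l := `|grad (V t) 0|.
move=> ys lL a0 a1 a2.
have y0 : 0 <= y by exact: normr_ge0.
have k0 : 0 <= `|K| by exact: normr_ge0.
have y1 : y <= 1 + s by have := sqr_ge0 (y - 1); nra.
apply: (le_trans a1); rewrite mulrDl; apply: lerD.
  by rewrite (le_trans a0)// ler_peMr// lerDl; apply: le_trans ys; rewrite sqr_ge0.
apply: (le_trans a2); rewrite -!mulrA ler_wpM2l// mulrDl mulrDl; apply: lerD.
  by apply: ler_pM => //; exact: normr_ge0.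
rewrite -!mulrA ler_wpM2l// ler_wpM2l// -expr2.
by apply: le_trans ys _; rewrite lerDr.
Qed.

End Solutions.

Section Hjb.
Context {R : realType}.
Variables (T : R) (n m d : nat) (c : coefficients R n m d).
Hypothesis hc : smoothness T c.

Lemma grows_vol0 i : grows T 1 (vol0 c i).
Proof.
case: hc => [[_ _ _ cC [_ cs]] _ _ _ _].
apply: growsD; first exact: (growsM (grows_time n (cC i)) (@grows_id _ _ _)).
exact: grows_le (grows_time n (cs i)).
Qed.

Lemma grows_drift : grows T 1 (fun t x => cA c t *m x + cb c t).
Proof.
case: hc => [[cA _ cb _ _] _ _ _ _].
apply: growsD; first exact: (growsM (grows_time n cA) (@grows_id _ _ _)).
exact: grows_le (grows_time n cb).
Qed.

(** The x-derivative of the control gradient is the mixed Hessian of l, which is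
    bounded. *)
Lemma grows_grad_control : grows T 1 (fun t x => grad (cl c t x) 0).
Proof.
case: hc => [_ _ [_ _ _ _ lm] [_ [_ clu] _ clxu _] [_ _ [K Kl] _ _]].
have [L L0 Lg] := cont_t_bounded (cont_tx_time (x := 0) (cont_txu_state (u := 0) clu)).
exists (L + n%:R * `|K|) => [|t x tT]; first by rewrite addr_ge0// mulr_ge0.
have cm : continuous (fun y => mixed (cl c t) y 0).
  exact: cont_tx_space (cont_txu_state (u := 0) clxu) tT.
have E j : grad (fun y => grad (cl c t y) 0 j ord0)
    = fun y => mixed (cl c t) y 0 *m basis_vec j.
  by apply/funext => y; rewrite -colE; apply/colP => i; rewrite !mxE.
have dl : `|grad (cl c t x) 0 - grad (cl c t 0) 0| <= n%:R * `|K| * `|x|.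
  apply: mx_norm_le => [|j i]; first by rewrite !mulr_ge0.
  have [|s _] := grad_mean_value 0 x ((lm _ tT).1 0 j).
    by rewrite E; exact: continuous_mulmxl.
  rewrite !add0r E (ord1 i) => e.
  have -> : (grad (cl c t x) 0 - grad (cl c t 0) 0) j ord0
      = grad (cl c t x) 0 j ord0 - grad (cl c t 0) 0 j ord0.
    by rewrite mxE [X in _ + X]mxE.
  rewrite e (le_trans (dot_le _ _))// ler_wpM2r// ler_wpM2l//.
  apply: mx_norm_le => // k l; rewrite -colE [X in `|X|]mxE.
  exact: le_trans (mx_entry_le _ _ _) (le_trans (Kl _ _ _ tT) (ler_norm _)).
have := Lg _ tT.
have := ler_normD (grad (cl c t 0) 0) (grad (cl c t x) 0 - grad (cl c t 0) 0).
rewrite [grad (cl c t 0) 0 + _]addrC subrK expr1 => a1 a2.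
have : 0 <= L * `|x| by rewrite mulr_ge0.
have : 0 <= n%:R * `|K| by rewrite mulr_ge0.
nra.
Qed.

(** The pre-Hamiltonian is quadratic in u except for l, and the hypothesis says
    that its second derivative in u is at least delta: expand l to second
    order at u = 0. *)
Lemma preHamiltonian_lower_bound t x p Q delta (u : 'cV[R]_m) :
  t \in `[0, T] ->
  (forall v, mxge (hess (cl c t x) v + \sum_i (cD c i t)^T *m Q *m cD c i t) delta%:M) ->
  preHamiltonian c t x p Q 0
    + dot u ((cB c t)^T *m p + \sum_i (cD c i t)^T *m Q *m vol0 c i t x
             + grad (cl c t x) 0) + delta / 2 * sqnorm u
  <= preHamiltonian c t x p Q u.
Proof.
move=> tT convex.
case: hc => [_ _ [_ gl _ hl _] [_ [_ clu] [_ cluu] _ _] _].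
pose S v := \sum_i dot ((cD c i t)^T *m Q *m cD c i t *m v) v.
have curv v : delta * sqnorm u - S u <= dot (hess (cl c t x) v *m u) u.
  have := convex v u; rewrite mulmxBl mulmxDl mul_scalar_mx dotBl dotDl dotZl.
  rewrite mulmx_suml dot_suml -/(sqnorm u) -/(S u); lra.
have := @taylor2_ge _ _ _ (gl _ x tT) (hl _ x tT)
  (cont_tx_space (cont_txu_control (x := x) clu) tT)
  (cont_tx_space (cont_txu_control (x := x) cluu) tT) 0 u _ curv.
rewrite add0r /preHamiltonian dot0l -/(S u) => taylor.
rewrite big1 => [|i _]; last by rewrite dotC dot0l.
rewrite !dotDr (dotC u (grad _ _)); lra.
Qed.

(** Uniform convexity in u bounds the sublevel set of the pre-Hamiltonian by an
    affine function of the size of its gradient at u = 0, and that gradient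
    grows linearly in x. *)
Lemma near_minimizer_growth V : C12 T V -> bounded_hess T V ->
  strongly_convex_control c T V -> exists2 K : R, 0 <= K & forall t x u,
    t \in `[0, T] ->
    preHamiltonian c t x (grad (V t) x) (hess (V t) x) u
      <= preHamiltonian c t x (grad (V t) x) (hess (V t) x) 0 + 1 ->
    `|u| <= K * (1 + `|x|).
Proof.
move=> CV [Kh hV] [delta delta0 conv].
have grow : grows T 1 (fun t x => (cB c t)^T *m grad (V t) x
    + \sum_i (cD c i t)^T *m hess (V t) x *m vol0 c i t x + grad (cl c t x) 0).
  case: hc => [[_ cB _ _ [cD _]] _ _ _ _].
  apply: growsD grows_grad_control; apply: growsD.
    exact: growsM (growsT (grows_time n cB)) (grows_grad CV (ex_intro _ Kh hV)).
  apply: grows_sum => i.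
  exact: growsM (growsM (growsT (grows_time n (cD i))) (grows_bounded hV))
    (grows_vol0 i).
case: grow => K K0 HK.
exists (1 + 2 / delta * (1 + m%:R * K)) => [|t x u tT near_min].
  by rewrite addr_ge0// mulr_ge0 ?divr_ge0 ?addr_ge0 ?mulr_ge0// ltW.
have := preHamiltonian_lower_bound (grad (V t) x) u tT (fun v => conv t x v tT).
set z := _ + grad (cl c t x) 0.
have zK : `|z| <= K * (1 + `|x|) := HK t x tT.
move=> low.
have dz := le_trans (ler_norm _) (dot_le (- u) z).
rewrite dotNl normrN in dz.
have un := sqnorm_ge_norm u.
set r := 1 + `|x|; have r1 : 1 <= r by rewrite lerDl.
have [u1|u1] := leP `|u| 1.
  apply: (le_trans u1); rewrite -[leLHS]mulr1 ler_pM// lerDl.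
  by rewrite mulr_ge0 ?divr_ge0 ?addr_ge0 ?mulr_ge0// ltW.
have key : delta / 2 * `|u| <= 1 + m%:R * K * r.
  rewrite -(@ler_pM2r _ `|u|) ?(lt_trans ltr01)//.
  have zr : m%:R * `|u| * `|z| <= m%:R * K * r * `|u|.
    by rewrite -mulrA mulrCA [leRHS]mulrC ler_wpM2l// -mulrA ler_wpM2l.
  have : delta / 2 * `|u| ^+ 2 <= delta / 2 * sqnorm u.
    by rewrite ler_wpM2l// divr_ge0// ltW.
  rewrite expr2 mulrDl mul1r; lra.
have -> : `|u| = 2 / delta * (delta / 2 * `|u|).
  by field; rewrite gt_eqF.
apply: (@le_trans _ _ (2 / delta * ((1 + m%:R * K) * r))); last first.
  by rewrite [leRHS]mulrDl mul1r mulrA lerDr (le_trans ler01).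
apply: ler_wpM2l; first by rewrite divr_ge0// ltW.
apply: (le_trans key).
by rewrite mulrDl mul1r lerD2r.
Qed.

End Hjb.

(** * Comparison of classical solutions *)

Lemma finite_uniform_bound {R : realType} d (X : Type) (D : X -> Prop)
    (f : 'I_d -> X -> R) (g : X -> R) : (forall z, 0 <= g z) ->
  (forall i, exists2 K, 0 <= K & forall z, D z -> f i z <= K * g z) ->
  exists2 K, 0 <= K & forall i z, D z -> f i z <= K * g z.
Proof.
move=> g0 H.
have /choice[k Hk] : forall i, exists K, 0 <= K /\ forall z, D z -> f i z <= K * g z.
  by move=> i; have [K K0 HK] := H i; exists K.
exists (\sum_i k i) => [|i z Dz]; first by apply: sumr_ge0 => i _; case: (Hk i).
apply: le_trans ((Hk i).2 z Dz) _; rewrite ler_wpM2r// (bigD1 i)//= lerDl.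
by apply: sumr_ge0 => j _; case: (Hk j).
Qed.

Section Arithmetic.
Context {R : realFieldType}.

Lemma near_min_le (a p p0 e : R) :
  a + p < e -> 0 <= a + p0 -> e <= 1 -> p <= p0 + 1.
Proof. lra. Qed.

Lemma sqr_1D_le (y s : R) : y ^+ 2 <= s -> (1 + y) ^+ 2 <= 2 * (1 + s).
Proof. have := sqr_ge0 (y - 1); nra. Qed.

(** The final count at the touching point: D, g, h are the contributions of the
    time derivative, drift and diffusion for the two solutions, l is the common
    running cost and q is (1 + |x|^2)^2.  The extra 1 in the rate
    C1 + C2 + 1 beats the error e. *)
Lemma touching_inequalities_absurd (D1 D2 g1 g2 h1 h2 k q C1 C2 l e : R) :
  D1 - D2 <= - (C1 + C2 + 1) * (k * q) -> g1 - g2 <= k * (C1 * q) ->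
  h1 - h2 <= k * q * C2 -> 0 <= D1 + (g1 + h1 + l) -> D2 + (g2 + h2 + l) < e ->
  e <= k / 2 -> 0 < k -> k <= k * q -> False.
Proof. nra. Qed.

End Arithmetic.

Section Comparison.
Context {R : realType}.
Variables (T : R) (hT : 0 < T) (n m d : nat) (c : coefficients R n m d).
Hypothesis hc : smoothness T c.

Lemma C12_hess_sym (V : R -> 'cV[R]_n -> R) t x a b : C12 T V -> t \in `[0, T] ->
  dot (hess (V t) x *m a) b = dot (hess (V t) x *m b) a.
Proof.
move=> [_ gV hV _ [cg ch]] tT.
exact: (hess_sym (gV _ tT) (hV _ tT) (cont_tx_space cg tT) (cont_tx_space ch tT)).
Qed.

(** The generator of the state equation when the control is frozen at u. *)
Definition controlled_generator (V : R -> 'cV[R]_n -> R) t x (u : 'cV[R]_m) : R :=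
  dot (grad (V t) x) (cA c t *m x + cb c t + cB c t *m u)
  + 2^-1 * \sum_i dot (hess (V t) x *m (vol0 c i t x + cD c i t *m u))
                      (vol0 c i t x + cD c i t *m u).

(** The pre-Hamiltonian contains the cross term <Q v, D u> once, whereas the
    completed square gives the average of <Q v, D u> and <Q D u, v>; the two
    agree because the Hessian Q is symmetric. *)
Lemma generator_preHamiltonian V t x u : C12 T V -> t \in `[0, T] ->
  generator c V t x + preHamiltonian c t x (grad (V t) x) (hess (V t) x) u
  = controlled_generator V t x u + cl c t x u.
Proof.
move=> CV tT; rewrite /generator /preHamiltonian /controlled_generator.
set p := grad (V t) x; set Q := hess (V t) x.
rewrite [dot u _]dotDr -dot_mulmx (dotC u) dot_suml.
rewrite [dot p (_ + _ + _)]dotDr (dotC p (cB c t *m u)).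
have -> : \sum_i dot (Q *m (vol0 c i t x + cD c i t *m u)) (vol0 c i t x + cD c i t *m u)
    = \sum_i dot (Q *m vol0 c i t x) (vol0 c i t x)
      + 2 * \sum_i dot ((cD c i t)^T *m Q *m vol0 c i t x) u
      + \sum_i dot ((cD c i t)^T *m Q *m cD c i t *m u) u.
  rewrite mulr_sumr -!big_split; apply: eq_bigr => i _ /=.
  have tr (w : 'cV[R]_n) : dot ((cD c i t)^T *m Q *m w) u = dot (Q *m w) (cD c i t *m u).
    by rewrite -mulmxA dot_mulmx trmxK.
  rewrite -[_ *m cD c i t *m u]mulmxA !tr.
  have := C12_hess_sym x (cD c i t *m u) (vol0 c i t x) CV tT; rewrite -/Q.
  move: (vol0 c i t x) (cD c i t *m u) => v w sym.
  by rewrite mulmxDr !dotDl !dotDr sym; ring.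
by field.
Qed.

Lemma Hamiltonian_solution V t x : classical_solution c T V -> t \in `[0, T] ->
  Hamiltonian c t x (grad (V t) x) (hess (V t) x)
  = (- (Dt T V t x + generator c V t x))%:E.
Proof.
move=> [_ /(_ t x) pde _] /pde.
case: (Hamiltonian _ _ _ _ _) => [h| |]//.
rewrite -EFinD => /eqP; rewrite eqe => /eqP H.
by congr EFin; apply/eqP; rewrite -subr_eq0 opprK addrC H.
Qed.

Lemma solution_ge0 V t x u : classical_solution c T V -> t \in `[0, T] ->
  0 <= Dt T V t x + generator c V t x
       + preHamiltonian c t x (grad (V t) x) (hess (V t) x) u.
Proof.
move=> sV tT; rewrite -lerBlDl sub0r -lee_fin -Hamiltonian_solution//.
by apply: ereal_inf_lbound; exists u.
Qed.

Lemma solution_near_min V t x eta : classical_solution c T V -> t \in `[0, T] ->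
  0 < eta -> exists u, Dt T V t x + generator c V t x
    + preHamiltonian c t x (grad (V t) x) (hess (V t) x) u < eta.
Proof.
move=> sV tT eta0.
have : (Hamiltonian c t x (grad (V t) x) (hess (V t) x)
    < (- (Dt T V t x + generator c V t x) + eta)%:E)%E.
  by rewrite Hamiltonian_solution// lte_fin ltrDl.
move=> /ereal_inf_lt[_ [u _ <-]]; rewrite lte_fin => H.
by exists u; rewrite -ltrBrDl addrC.
Qed.

(** The control chosen at the touching point is nearly optimal for V2; strong
    convexity of the pre-Hamiltonian of V2 keeps it of linear growth. *)
Lemma classical_solution_le (V1 V2 : R -> 'cV[R]_n -> R) :
  classical_solution c T V1 -> bounded_hess T V1 ->
  classical_solution c T V2 -> bounded_hess T V2 -> strongly_convex_control c T V2 ->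
  forall t x, t \in `[0, T] -> V1 t x <= V2 t x.
Proof.
move=> s1 h1 s2 h2 conv2 t' x' t'T; rewrite leNgt; apply/negP => gap.
have [[C1 _ g1] [C2 _ g2]] := (s1, s2).
have [K1 K10 B1] := value_quadratic_growth C1 h1.
have [K2 K20 B2] := value_quadratic_growth C2 h2.
have [Ku Ku0 Bu] := near_minimizer_growth hc C2 h2 conv2.
have [Kb Kb0 Bb] := grows_drift hc.
have [[_ contB _ _ [contD _]] _ _ _ _] := hc.
have [KB KB0 BB] := cont_t_bounded contB.
have [Kv Kv0 Bv] : exists2 K, 0 <= K & forall i (z : R * 'cV[R]_n),
    z.1 \in `[0, T] -> `|vol0 c i z.1 z.2| <= K * (1 + `|z.2|).
  apply: finite_uniform_bound => [z|i]; first by rewrite addr_ge0.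
  by have [K K0 HK] := grows_vol0 hc i; exists K => // z; exact: HK.
have [KD KD0 BD] : exists2 K, 0 <= K & forall i t, t \in `[0, T] -> `|cD c i t| <= K * 1.
  apply: (finite_uniform_bound (g := fun=> 1)) => [//|i].
  by have [K K0 HK] := cont_t_bounded (contD i); exists K => // z zT; rewrite mulr1 HK.
pose Mb := Kb + m%:R * KB * Ku; pose Ms := Kv + m%:R * KD * Ku.
have Mb0 : 0 <= Mb by rewrite addr_ge0// !mulr_ge0.
have Ms0 : 0 <= Ms by rewrite addr_ge0// !mulr_ge0.
pose N : R := n%:R; have N0 : 0 <= N by [].
(* With r = 1 + |x| in the max norm and q = 1 + |x|^2 in the Euclidean norm,
   r^2 <= 2 q; drift and volatility are at most Mb r and Ms r, so the diffusion
   operator maps q^2 below C q^2. *)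
pose C := 8 * N * Mb + d%:R * (4 * N * Ms ^+ 2 + 16 * N ^+ 2 * Ms ^+ 2).
have C0 : 0 <= C by rewrite addr_ge0 ?mulr_ge0 ?addr_ge0 ?mulr_ge0 ?exprn_ge0.
have growth t x : t \in `[0, T] -> V1 t x - V2 t x <= (K1 + K2) * (1 + sqnorm x).
  move=> tT; rewrite mulrDl (le_trans (ler_norm _))// (le_trans (ler_normB _ _))//.
  by rewrite lerD ?B1 ?B2.
have terminal x : V1 T x <= V2 T x by rewrite g1 g2.
have l0 : 0 <= C + 1 by rewrite addr_ge0.
have [k [t [x [k0 tT dt dx]]]] :=
  exists_touching_point hT l0 C1 C2 growth terminal t'T gap.
pose q := 1 + sqnorm x; have q1 : 1 <= q by rewrite lerDl sqnorm_ge0.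
(* eta <= 1 for the growth of u, eta <= k / 2 for the final contradiction *)
pose eta := Num.min 1 (k / 2).
have eta0 : 0 < eta by rewrite lt_min ltr01 divr_gt0.
have [eta1 etak] : eta <= 1 /\ eta <= k / 2 by rewrite !ge_min !lexx orbT.
have [u near_min] := solution_near_min x s2 tT eta0.
have zero2 := solution_ge0 x 0 s2 tT.
have ge1 := solution_ge0 x u s1 tT.
pose r := 1 + `|x|; have r0 : 0 <= r by rewrite addr_ge0.
have ur : `|u| <= Ku * r by exact: Bu tT (near_min_le near_min zero2 eta1).
have rq : r ^+ 2 <= 2 * q.
  exact/sqr_1D_le/sqnorm_ge_norm.
rewrite -addrA generator_preHamiltonian// in ge1.
rewrite -addrA generator_preHamiltonian// in near_min.
pose bu := cA c t *m x + cb c t + cB c t *m u.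
pose su i := vol0 c i t x + cD c i t *m u.
have bur : `|bu| <= Mb * r.
  rewrite (le_trans (ler_normD _ _))// /Mb mulrDl lerD//; first exact: (Bb t x tT).
  rewrite (le_trans (mulmx_norm_le _ _))// -[leRHS]mulrA ler_pM ?mulr_ge0//.
  by rewrite ler_wpM2l// BB.
have sur i : `|su i| <= Ms * r.
  rewrite (le_trans (ler_normD _ _))// /Ms mulrDl lerD//; first exact: (Bv i (t, x) tT).
  rewrite (le_trans (mulmx_norm_le _ _))// -[leRHS]mulrA ler_pM ?mulr_ge0//.
  by rewrite ler_wpM2l// -[leRHS]mulr1 BD.
have xw (w : 'cV[R]_n) M : 0 <= M -> `|w| <= M * r -> `|dot x w| <= 2 * N * M * q.
  move=> M0 wM; rewrite (le_trans (dot_le _ _))// -/N.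
  rewrite -mulrA [leRHS](_ : _ = N * (M * (2 * q))); last by ring.
  rewrite ler_wpM2l// (@le_trans _ _ (r * (M * r)))//.
    by rewrite ler_pM// lerDr.
  by rewrite mulrCA -expr2 ler_wpM2l.
have ww (w : 'cV[R]_n) M : 0 <= M -> `|w| <= M * r -> sqnorm w <= 2 * N * M ^+ 2 * q.
  move=> M0 wM; rewrite (le_trans (sqnorm_le _))// -/N.
  rewrite [leRHS](_ : _ = N * (M ^+ 2 * (2 * q))); last by ring.
  rewrite ler_wpM2l// (@le_trans _ _ ((M * r) ^+ 2))//.
    by rewrite lerXn2r ?nnegrE ?mulr_ge0.
  by rewrite exprMn ler_wpM2l// exprn_ge0.
have dgrad : dot (grad (V1 t) x) bu - dot (grad (V2 t) x) bu <= k * (8 * N * Mb * q ^+ 2).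
  rewrite -dotBl (dx bu).1 ler_wpM2l ?(ltW k0)// -/q.
  rewrite [leRHS](_ : _ = 4 * q * (2 * N * Mb * q)); last by ring.
  rewrite ler_wpM2l ?(le_trans (ler_norm _) (xw _ _ Mb0 bur))//.
  by rewrite mulr_ge0// (le_trans ler01).
have dhess i : dot (hess (V1 t) x *m su i) (su i) - dot (hess (V2 t) x *m su i) (su i)
    <= 2 * k * q ^+ 2 * (4 * N * Ms ^+ 2 + 16 * N ^+ 2 * Ms ^+ 2).
  rewrite -dotBl -mulmxBl (le_trans (dx (su i)).2)// -/q.
  rewrite [leRHS](_ : _ = k * (4 * q * (2 * N * Ms ^+ 2 * q) + 8 * (2 * N * Ms * q) ^+ 2)).
    rewrite ler_wpM2l ?(ltW k0)// lerD//.
      by rewrite ler_wpM2l ?ww// mulr_ge0// (le_trans ler01).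
    rewrite ler_wpM2l// -[leLHS]real_normK ?num_real// lerXn2r ?nnegrE ?xw//.
    by rewrite !mulr_ge0// (le_trans ler01).
  by ring.
have dsum : 2^-1 * \sum_i dot (hess (V1 t) x *m su i) (su i)
    - 2^-1 * \sum_i dot (hess (V2 t) x *m su i) (su i)
    <= k * q ^+ 2 * (d%:R * (4 * N * Ms ^+ 2 + 16 * N ^+ 2 * Ms ^+ 2)).
  rewrite -mulrBr -sumrB ler_pdivrMl//.
  rewrite (le_trans (ler_sum _ (fun i _ => dhess i)))// sumr_const card_ord.
  by rewrite -mulr_natl le_eqVlt; apply/orP; left; apply/eqP; ring.
have kq : k <= k * q ^+ 2 by rewrite ler_peMr ?(ltW k0)// exprn_ege1.
rewrite /controlled_generator -/bu in ge1 near_min.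
rewrite -/q in dt.
exact: touching_inequalities_absurd dt dgrad dsum ge1 near_min etak k0 kq.
Qed.

End Comparison.

(** * Convex data *)

Section Convexity.
Context {R : realType}.

Lemma convex_midpoint (E : lmodType R) (f : E -> R) x y :
  convex_function setT f -> f x *+ 2 <= f (x + y) + f (x - y).
Proof.
move=> cf; have half0 : 0 <= (2^-1 : R) <= 1 by lra.
have := cf (Itv01 (andP half0).1 (andP half0).2) (x + y) (x - y).
rewrite !inE => /(_ I I).
have -> : conv (Itv01 (andP half0).1 (andP half0).2)
    (x + y : convex_lmodType E) (x - y) = x.
  rewrite [LHS](_ : _ = 2^-1 *: (x + y) + (1 - 2^-1) *: (x - y))//.
  rewrite (_ : 1 - 2^-1 = 2^-1 :> R); last by field.
  rewrite -scalerDr addrACA subrr addr0 -mulr2n -[x *+ 2]scaler_nat scalerA.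
  by rewrite mulVf ?scale1r.
rewrite [leRHS](_ : _ = 2^-1 * f (x + y) + (1 - 2^-1) * f (x - y))//; lra.
Qed.

(** A negligible set contains no nondegenerate interval, so a property that holds
    almost everywhere on [0, T] holds arbitrarily close to t, also when t is an
    endpoint. *)
Lemma ae_time_dense (T : R) (A : R -> Prop) t e : 0 < T -> t \in `[0, T] -> 0 < e ->
  {ae @lebesgue_measure R, forall s, s \in `[0, T] -> A s} ->
  exists s, [/\ s \in `[0, T], `|t - s| < e & A s].
Proof.
move=> T0 tT e0 aeA; apply: contrapT => none.
move: (tT); rewrite in_itv/= => /andP[t0 tT'].
pose a := Num.max 0 (t - e); pose b := Num.min T (t + e).
have ab : a < b.
  rewrite gt_max !lt_min T0 ltr_wpDl//= (lt_le_trans _ tT')/=; lra.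
have ngl : (@lebesgue_measure R).-negligible [set` `]a, b[%R].
  apply: negligibleS aeA => s /=; rewrite in_itv/= lt_min gt_max.
  move=> /andP[/andP[s0 ts] /andP[sT st]] sA; apply: none.
  have sI : s \in `[0, T] by rewrite in_itv/= (ltW s0) (ltW sT).
  exists s; split => //; last exact: sA.
  by rewrite distrC ltr_norml; apply/andP; split; lra.
have : @lebesgue_measure R [set` `]a, b[%R] = 0%E.
  by apply: measure_negligible => //; exact: measurable_itv.
rewrite lebesgue_measure_itv/= lte_fin ab -EFinB => -[] /eqP.
by rewrite subr_eq0 gt_eqF.
Qed.

Lemma ae_time_ge0 (T : R) (f : R -> R) t : 0 < T -> t \in `[0, T] -> cont_t T f ->
  {ae @lebesgue_measure R, forall s, s \in `[0, T] -> 0 <= f s} -> 0 <= f t.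
Proof.
move=> T0 tT /subspace_continuousP/(_ t tT) cf aef; rewrite leNgt; apply/negP => ft.
have : \forall s \near within `[0, T] (nbhs t), f s < 0 by exact: cvgr_lt cf _ ft.
case=> e /= e0 He.
have [s [sT ts fs]] := ae_time_dense T0 tT e0 aef.
by have := He s ts sT; rewrite ltNge fs.
Qed.

Variables (T : R) (hT : 0 < T) (n m d : nat) (c : coefficients R n m d).
Hypothesis hc : smoothness T c.

Lemma convex_hess_ge0 (V : R -> 'cV[R]_n -> R) t x v : C12 T V -> t \in `[0, T] ->
  convex_function setT (V t) -> 0 <= dot (hess (V t) x *m v) v.
Proof.
move=> [_ gV hV _ [cg ch]] tT conv.
apply: (second_difference_hess_ge (gV _ tT) (hV _ tT)
  (cont_tx_space cg tT) (cont_tx_space ch tT)) => s.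
by rewrite mul0r subr_ge0 convex_midpoint.
Qed.

(** The hypothesis holds for almost every time only.  The midpoint inequality it
    implies is closed and continuous in time, so it extends to every time before
    second derivatives are taken. *)
Lemma convex_data_hess_control : convex_data T c -> exists2 delta : R, 0 < delta &
  forall t x u v, t \in `[0, T] ->
    delta * sqnorm v <= dot (hess (cl c t x) u *m v) v.
Proof.
move=> [delta delta0 conv]; exists delta => // t x u v tT.
have [_ _ [_ gl _ hl _] [cl_ [_ clu] [_ cluu] _ _] _] := hc.
apply: (second_difference_hess_ge (gl _ x tT) (hl _ x tT)
  (cont_tx_space (cont_txu_control (x := x) clu) tT)
  (cont_tx_space (cont_txu_control (x := x) cluu) tT)) => s.
rewrite -subr_ge0.
pose F r := cl c r x (u + s *: v) + cl c r x (u - s *: v) - cl c r x u *+ 2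
  - delta * sqnorm v * s ^+ 2.
have cF : cont_t T F.
  have ct w : cont_t T (fun r => cl c r x w).
    exact: cont_tx_time (cont_txu_control (x := x) cl_).
  apply: within_continuousB; last exact/continuous_subspaceT/cst_continuous.
  apply: within_continuousB; first exact: (within_continuousD (ct _) (ct _)).
  exact: (within_continuousD (ct _) (ct _)).
apply: (ae_time_ge0 hT tT cF); apply: negligibleS conv => r nF H; apply: nF => rT.
have [_ convl] := H rT.
have := convex_midpoint (x, u) (0, s *: v) convl.
have parallelogram : sqnorm (u + s *: v) + sqnorm (u - s *: v)
    = sqnorm u *+ 2 + (s ^+ 2 * sqnorm v) *+ 2.
  by rewrite -scaleNr !sqnorm_line sqrrN; ring.
have := congr1 (fun z => delta / 2 * z) parallelogram.
rewrite /= addr0 subr0 /F; lra.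
Qed.

(** Convexity of V makes each D_i^T V'' D_i positive semidefinite, so adding
    these terms preserves the lower bound on the Hessian of l in u. *)
Lemma convex_strongly_convex_control (V : R -> 'cV[R]_n -> R) :
  convex_data T c -> C12 T V ->
  (forall t, t \in `[0, T] -> convex_function setT (V t)) ->
  strongly_convex_control c T V.
Proof.
move=> /convex_data_hess_control[delta delta0 hl] CV convV.
exists delta => // t x u tT v.
rewrite mulmxBl mulmxDl mul_scalar_mx mulmx_suml dotBl dotDl dotZl dot_suml.
have := hl t x u v tT; rewrite -/(sqnorm v).
have : 0 <= \sum_i dot ((cD c i t)^T *m hess (V t) x *m cD c i t *m v) v.
  apply: sumr_ge0 => i _; rewrite -!mulmxA dot_mulmx trmxK.
  exact: convex_hess_ge0 CV tT (convV t tT).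
lra.
Qed.

End Convexity.

Theorem corollary5p7 (R : realType) (T : R) (hT : 0 < T)
    (n m d : nat) (hn : (1 <= n)%N) (hm : (1 <= m)%N) (hd : (1 <= d)%N)
    (dsp : measure_display) (Omega : measurableType dsp)
    (P : probability Omega R) (P_complete : measure_is_complete P)
    (W : R -> Omega -> 'cV[R]_d) (hW : brownian_motion P W T)
    (c : coefficients R n m d) (hc : smoothness T c) :
  (uniform_convexity P W T c ->
   forall V1 V2 : R -> 'cV[R]_n -> R,
     [/\ classical_solution c T V1, bounded_hess T V1
       & strongly_convex_control c T V1] ->
     [/\ classical_solution c T V2, bounded_hess T V2
       & strongly_convex_control c T V2] ->
     forall t x, t \in `[0, T] -> V1 t x = V2 t x)
  /\
  (convex_data T c ->
   forall V1 V2 : R -> 'cV[R]_n -> R,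
     [/\ classical_solution c T V1, bounded_hess T V1
       & forall t, t \in `[0, T] -> convex_function setT (V1 t)] ->
     [/\ classical_solution c T V2, bounded_hess T V2
       & forall t, t \in `[0, T] -> convex_function setT (V2 t)] ->
     forall t x, t \in `[0, T] -> V1 t x = V2 t x).
Proof.
have unique (V1 V2 : R -> 'cV[R]_n -> R) :
    [/\ classical_solution c T V1, bounded_hess T V1
      & strongly_convex_control c T V1] ->
    [/\ classical_solution c T V2, bounded_hess T V2
      & strongly_convex_control c T V2] ->
    forall t x, t \in `[0, T] -> V1 t x = V2 t x.
  move=> [s1 h1 k1] [s2 h2 k2] t x tT; apply/eqP; rewrite eq_le.
  by rewrite (classical_solution_le hT hc s1 h1) ?(classical_solution_le hT hc s2 h2).
split=> [_|conv V1 V2 [s1 h1 c1] [s2 h2 c2]]; first exact: unique.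
have [[C1 _ _] [C2 _ _]] := (s1, s2).
by apply: unique; split=> //; exact: convex_strongly_convex_control.
Qed.
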